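(* Let $p_1$ be odd, let $p_2$ be an even divisor of $2p_1$, and let $p_3$ be even. Then $\mathcal{P}(p_1,p_2,p_3)$ is a tight orientably-regular polytope of type $\{p_1,p_2,p_3\}$.
   Context: For such a triple, $\Gamma(p_1,p_2,p_3)$ is the group generated by $x_0,x_1,x_2,x_3$ subject to $x_j^2=1$, $(x_{j-1}x_j)^{p_j}=1$ ($1\le j\le 3$), $(x_jx_k)^2=1$ for $|j-k|\ge 2$, $(x_0x_1x_2x_1x_2)^2=1$ and $(x_1x_2x_3x_2)^2=1$. $\mathcal{P}(p_1,p_2,p_3)$ is the poset built from $\Gamma=\Gamma(p_1,p_2,p_3)$: for $0\le j\le 3$ its $j$-faces are the right cosets of $\Gamma_j=\langle x_k:k\ne j\rangle$, with $\Gamma_j\varphi\le\Gamma_k\psi$ iff $j\le k$ and the cosets intersect, together with a least face of rank $-1$ and a greatest face of rank $4$. An abstract polytope of rank $4$ is a ranked poset (ranks $-1$ to $4$) with unique least and greatest faces, flags of $6$ faces, connected sections and the diamond condition; it has type $\{a,b,c\}$ if its $2$-faces are $a$-gons, the sections between vertices and incident $3$-faces are $b$-gons, and the sections between edges and the greatest face are $c$-gons; it is tight if it has exactly $2abc$ flags; it is regular if its automorphism group is flag-transitive (generated by reflections $\rho_0,\ldots,\rho_3$ relative to a base flag), and orientably-regular if the rotation subgroup $\langle\rho_{j-1}\rho_j\rangle$ has index $2$. *)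

(* Defs.v *)
From HB Require Import structures.
From mathcomp Require Import all_boot all_order ssralg ssrnum ssrint.
From mathcomp Require Import boolp classical_sets functions cardinality.

Set Implicit Arguments.
Unset Strict Implicit.
Unset Printing Implicit Defensive.

Import Order.TTheory GRing.Theory Num.Theory.

Local Open Scope classical_set_scope.
Local Open Scope card_scope.
Local Open Scope group_scope.
Local Open Scope quotient_scope.

Section Subgroups.
Variable G : groupType.
Implicit Types (S T H : set G) (x y : G).

Definition is_subgroup H := H 1 /\ forall x y, H x -> H y -> H (x / y).

Definition gen_subgroup S : set G := smallest is_subgroup S.

Definition right_coset H x : set G := [set h * x | h in H].

Definition right_cosets H : set (set G) := range (right_coset H).

Lemma is_subgroupV H x : is_subgroup H -> H x -> H x^-1.
Proof. by move=> [H1 HB] Hx; rewrite -[x^-1]mul1g; exact: HB. Qed.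

Lemma is_subgroupM H x y : is_subgroup H -> H x -> H y -> H (x * y).
Proof.
move=> sH Hx Hy; rewrite -[y]invgK.
by apply: sH.2 => //; exact: is_subgroupV.
Qed.

Lemma gen_subgroupP S : is_subgroup (gen_subgroup S).
Proof.
split=> [H [[]]//|x y Sx Sy H HS].
by apply: HS.1.2; [exact: Sx|exact: Sy].
Qed.

Lemma sub_gen_subgroup S : S `<=` gen_subgroup S.
Proof. by move=> x Sx H [_]; exact. Qed.

Lemma gen_subgroup_min S H : is_subgroup H -> S `<=` H -> gen_subgroup S `<=` H.
Proof. by move=> sH SH x; exact. Qed.

Lemma gen_subgroupS S S' : S `<=` S' -> gen_subgroup S `<=` gen_subgroup S'.
Proof.
move=> SS'; apply: gen_subgroup_min; first exact: gen_subgroupP.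
by move=> x /SS'; exact: sub_gen_subgroup.
Qed.

Lemma right_cosetP H x y z : is_subgroup H ->
  right_coset H x y -> right_coset H x z <-> H (z / y).
Proof.
move=> sH [h Hh <-]; split=> [[k Hk <-]|Hz].
  by rewrite invgM mulgA mulgK; exact: sH.2.
exists (z / x); last by rewrite mulgVK.
have -> : z / x = z / (h * x) * h by rewrite invgM mulgA mulgVK.
exact: is_subgroupM.
Qed.

Lemma is_subgroup_centraliser S :
  is_subgroup [set x | forall y, S y -> x * y = y * x].
Proof.
split=> [y _|x y cx cy z Sz]; first by rewrite mul1g mulg1.
have cVy : y^-1 * z = z * y^-1.
  by apply: (@mulgI _ y); rewrite mulgA mulgV mul1g mulgA cy// mulgK.
by rewrite -mulgA cVy !mulgA cx.
Qed.

Lemma gen_subgroup_comm S T :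
  (forall x y, S x -> T y -> x * y = y * x) ->
  forall x y, gen_subgroup S x -> gen_subgroup T y -> x * y = y * x.
Proof.
move=> ST.
have SgT : gen_subgroup S `<=` [set x | forall y, T y -> x * y = y * x].
  apply: gen_subgroup_min (@is_subgroup_centraliser T) _ => x Sx y.
  exact: ST.
suff TgS : gen_subgroup T `<=`
    [set y | forall x, gen_subgroup S x -> y * x = x * y].
  by move=> x y Sx Ty; rewrite (TgS y Ty x Sx).
apply: gen_subgroup_min (@is_subgroup_centraliser _) _ => y Ty x Sx.
by rewrite (SgT x Sx y Ty).
Qed.

End Subgroups.

(* The letter (x, true) stands for the generator x and (x, false) for its
   inverse. *)
Definition word (X : Type) := seq (X * bool).

Definition wpow X (w : word X) (n : nat) : word X := flatten (nseq n w).

Section Presentation.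
Variables (X : choiceType) (R : set (word X)).

Inductive word_eq : word X -> word X -> Prop :=
| word_eq_refl u : word_eq u u
| word_eq_sym u v : word_eq u v -> word_eq v u
| word_eq_trans u v w : word_eq u v -> word_eq v w -> word_eq u w
| word_eq_cancel u v x b : word_eq (u ++ [:: (x, b); (x, ~~ b)] ++ v) (u ++ v)
| word_eq_relator u v r : R r -> word_eq (u ++ r ++ v) (u ++ v).

Definition word_eqb : rel (word X) := fun u v => `[< word_eq u v >].

Fact word_eqb_equiv : equiv_class_of word_eqb.
Proof.
split=> [u|u v|v u w]; first exact/asboolP/word_eq_refl.
  by apply/asboolP/asboolP; exact: word_eq_sym.
by move=> /asboolP uv /asboolP vw; apply/asboolP/(word_eq_trans uv vw).
Qed.

Canonical word_equiv := EquivRelPack word_eqb_equiv.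

Definition presented := {eq_quot word_equiv}.

HB.instance Definition _ := Choice.on presented.

Definition of_word (u : word X) : presented := \pi u.

Definition presented_gen (x : X) : presented := of_word [:: (x, true)].

Definition word_inv (u : word X) : word X :=
  rev [seq (a.1, ~~ a.2) | a <- u].

Definition presented_one : presented := of_word [::].
Definition presented_inv (a : presented) := of_word (word_inv (repr a)).
Definition presented_mul (a b : presented) := of_word (repr a ++ repr b).

Lemma of_wordP u v : of_word u = of_word v <-> word_eq u v.
Proof.
split=> [/eqP|uv]; first by rewrite /of_word eqmodE => /asboolP.
by apply/eqP; rewrite /of_word eqmodE; apply/asboolP.
Qed.

Lemma of_word_repr (a : presented) : of_word (repr a) = a.
Proof. exact: reprK. Qed.

Lemma word_eq_repr u : word_eq (repr (of_word u)) u.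
Proof. by apply/of_wordP; rewrite of_word_repr. Qed.

Lemma word_eq_cat u u' v v' :
  word_eq u u' -> word_eq v v' -> word_eq (u ++ v) (u' ++ v').
Proof.
move=> uu' vv'; apply: (@word_eq_trans _ (u' ++ v)).
  elim: uu' => {u u'} [u|u w _ ?|u w z _ ? _ ?|u w x b|u w r Rr].
  - exact: word_eq_refl.
  - exact: word_eq_sym.
  - exact: word_eq_trans (w ++ v) _ _ _.
  - by rewrite -!catA; exact: word_eq_cancel.
  - by rewrite -!catA; exact: word_eq_relator.
elim: vv' => {v v'} [v|v w _ ?|v w z _ ? _ ?|v w x b|v w r Rr].
- exact: word_eq_refl.
- exact: word_eq_sym.
- exact: word_eq_trans (u' ++ w) _ _ _.
- by rewrite !(catA u'); exact: word_eq_cancel.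
- by rewrite !(catA u'); exact: word_eq_relator.
Qed.

Lemma of_wordM u v : presented_mul (of_word u) (of_word v) = of_word (u ++ v).
Proof. by apply/of_wordP/word_eq_cat; exact: word_eq_repr. Qed.

Lemma word_eq_mulV u : word_eq (u ++ word_inv u) [::].
Proof.
elim: u => [|[x b] u IH]; first exact: word_eq_refl.
rewrite /word_inv /= rev_cons -cats1 -cat1s (catA u).
apply: (@word_eq_trans _ ([:: (x, b)] ++ [::] ++ [:: (x, ~~ b)])).
  apply: word_eq_cat (word_eq_refl _) _.
  exact: word_eq_cat IH (word_eq_refl _).
exact: (word_eq_cancel [::] [::]).
Qed.

Lemma word_invK : involutive word_inv.
Proof.
move=> u; rewrite /word_inv map_rev revK -map_comp.
by rewrite -[RHS]map_id; apply: eq_map => -[x b] /=; rewrite negbK.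
Qed.

Lemma word_eq_mulVl u : word_eq (word_inv u ++ u) [::].
Proof. by rewrite -{2}[u]word_invK; exact: word_eq_mulV. Qed.

Fact presented_mulA : associative presented_mul.
Proof.
move=> a b c; rewrite -[a]of_word_repr -[b]of_word_repr -[c]of_word_repr.
by rewrite !of_wordM catA.
Qed.

Fact presented_mul1 : left_id presented_one presented_mul.
Proof. by move=> a; rewrite -[a]of_word_repr of_wordM. Qed.

Fact presented_mulr1 : right_id presented_one presented_mul.
Proof. by move=> a; rewrite -[a]of_word_repr of_wordM cats0. Qed.

Fact presented_mulV : left_inverse presented_one presented_inv presented_mul.
Proof.
move=> a; rewrite -{2}[a]of_word_repr of_wordM.
exact/of_wordP/word_eq_mulVl.
Qed.

Fact presented_mulrV : right_inverse presented_one presented_inv presented_mul.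
Proof.
move=> a; rewrite -{1}[a]of_word_repr of_wordM.
exact/of_wordP/word_eq_mulV.
Qed.

HB.instance Definition _ := isGroup.Build presented
  presented_mulA presented_mul1 presented_mulr1 presented_mulV presented_mulrV.

End Presentation.

Section Polytopes.
Local Open Scope order_scope.
Variables (d : Order.disp_t) (P : tbPOrderType d) (n : nat) (rk : P -> int).
Implicit Types (F G H : P) (A B : set P).

Definition is_chain A := forall F G, A F -> A G -> F >=< G.

Definition is_flag A := is_chain A /\ forall B, is_chain B -> A `<=` B -> A = B.

Definition is_ranked :=
  [/\ rk \bot = (-1)%R,
      rk \top = n%:Z%R,
      forall F G, F < G -> rk F < rk G
    & forall F G, F < G -> (forall H, ~ F < H < G) -> rk G = (rk F + 1)%R].

(* The section G/F, that is the interval from F to G, has rank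
   rk G - rk F - 1; sections of rank at most 1 are connected by convention. *)
Definition connected_section F G := forall H H',
  F < H < G -> F < H' < G ->
  exists s : seq P, [/\ path >=<%O H s, last H s = H'
                      & all (fun K => F < K < G) s].

Definition connected_sections := forall F G,
  F <= G -> (rk F + 3 <= rk G)%R -> connected_section F G.

Definition diamond_condition := forall F G,
  F < G -> rk G = (rk F + 2)%R -> [set H | F < H < G] #= `I_2.

Definition is_polytope :=
  [/\ is_ranked,
      forall A, is_flag A -> A #= `I_n.+2,
      connected_sections
    & diamond_condition].

(* The vertices v i and edges e i (i modulo p) of the section G/F are arranged
   as in a p-gon, the edge e i joining the vertices v i and v (i + 1). *)
Definition section_is_gon (p : nat) F G :=
  rk G = (rk F + 3)%R /\
  exists v e : 'I_p -> P,
    [/\ injective v, injective e,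
        range v = [set H | F < H < G /\ rk H = (rk F + 1)%R],
        range e = [set H | F < H < G /\ rk H = (rk F + 2)%R]
      & forall i j, v i <= e j <-> i = j \/ i = ordS j].

Definition has_type4 (a b c : nat) :=
  [/\ forall F, rk F = 2%R -> section_is_gon a \bot F,
      forall F G, rk F = 0%R -> rk G = 3%R -> F < G -> section_is_gon b F G
    & forall F, rk F = 1%R -> section_is_gon c F \top].

(* Meaningful for a polytope of type {a, b, c}. *)
Definition is_tight4 (a b c : nat) :=
  [set A | is_flag A] #= `I_(2 * a * b * c)%N.

Definition is_automorphism (f : P -> P) :=
  bijective f /\ {mono f : F G / F <= G}.

Definition aut := set_type [set f | is_automorphism f].

HB.instance Definition _ := Choice.on aut.

Definition aut_fun (f : aut) : P -> P := val f.

Lemma aut_funP f : is_automorphism (aut_fun f).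
Proof. exact: set_valP f. Qed.

Lemma aut_eq (f g : aut) : aut_fun f =1 aut_fun g -> f = g.
Proof. by move=> fg; apply/val_inj/funext. Qed.

Fact idfun_automorphism : is_automorphism idfun.
Proof. by split=> //; exists idfun. Qed.

Fact comp_automorphism (f g : aut) :
  is_automorphism (aut_fun g \o aut_fun f).
Proof.
have [[bf mf] [bg mg]] := (aut_funP f, aut_funP g).
by split=> [|F G /=]; [exact: bij_comp|rewrite mg mf].
Qed.

Fact aut_inverse (f : aut) : exists g,
  [/\ is_automorphism g, cancel (aut_fun f) g & cancel g (aut_fun f)].
Proof.
have [[g fK gK] mf] := aut_funP f.
exists g; split=> //; split; first by exists (aut_fun f).
by move=> F G; rewrite -mf !gK.
Qed.

Definition aut_one : aut := SigSub (mem_set idfun_automorphism).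
Definition aut_mul (f g : aut) : aut :=
  SigSub (mem_set (comp_automorphism f g)).
Definition aut_inv (f : aut) : aut :=
  let: exist _ gP := cid (aut_inverse f) in
  let: And3 autg _ _ := gP in SigSub (mem_set autg).

Fact aut_mulA : associative aut_mul.
Proof. by move=> f g h; exact: aut_eq. Qed.
Fact aut_mul1 : left_id aut_one aut_mul.
Proof. by move=> f; exact: aut_eq. Qed.
Fact aut_mulr1 : right_id aut_one aut_mul.
Proof. by move=> f; exact: aut_eq. Qed.
Fact aut_mulV : left_inverse aut_one aut_inv aut_mul.
Proof.
move=> f; apply: aut_eq => F; rewrite /= /aut_inv.
by case: cid => g [ag fK gK]; exact: gK.
Qed.
Fact aut_mulrV : right_inverse aut_one aut_inv aut_mul.
Proof.
move=> f; apply: aut_eq => F; rewrite /= /aut_inv.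
by case: cid => g [ag fK gK]; exact: fK.
Qed.

(* Automorphisms act on the right: f * g is f followed by g. *)
HB.instance Definition _ :=
  isGroup.Build aut aut_mulA aut_mul1 aut_mulr1 aut_mulV aut_mulrV.

Definition is_regular := forall A B, is_flag A -> is_flag B ->
  exists f : aut, aut_fun f @` A = B.

Definition adjacent (j : int) A B :=
  A <> B /\ forall F, rk F <> j -> A F <-> B F.

Definition base_reflections A (rho : 'I_n -> aut) :=
  forall j : 'I_n, adjacent j%:Z%R A (aut_fun (rho j) @` A).

Definition rotation_subgroup (rho : 'I_n -> aut) : set aut :=
  gen_subgroup
    [set s | exists i j : 'I_n, j = i.+1 :> nat /\ s = rho i * rho j].

Definition is_orientably_regular :=
  is_regular /\
  forall A, is_flag A -> exists rho : 'I_n -> aut,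
    [/\ base_reflections A rho,
        gen_subgroup (range rho) = setT
      & right_cosets (rotation_subgroup rho) #= `I_2].

End Polytopes.

Definition x_ (j : nat) : word 'I_4 := [:: (inord j, true)].

Inductive Gamma_relator (p1 p2 p3 : nat) : set (word 'I_4) :=
| Gamma_sqr (j : 'I_4) : Gamma_relator p1 p2 p3 (wpow (x_ j) 2)
| Gamma_p1 : Gamma_relator p1 p2 p3 (wpow (x_ 0 ++ x_ 1) p1)
| Gamma_p2 : Gamma_relator p1 p2 p3 (wpow (x_ 1 ++ x_ 2) p2)
| Gamma_p3 : Gamma_relator p1 p2 p3 (wpow (x_ 2 ++ x_ 3) p3)
| Gamma_comm (j k : 'I_4) : (j.+2 <= k)%N || (k.+2 <= j)%N ->
    Gamma_relator p1 p2 p3 (wpow (x_ j ++ x_ k) 2)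
| Gamma_01212 :
    Gamma_relator p1 p2 p3 (wpow (x_ 0 ++ x_ 1 ++ x_ 2 ++ x_ 1 ++ x_ 2) 2)
| Gamma_1232 :
    Gamma_relator p1 p2 p3 (wpow (x_ 1 ++ x_ 2 ++ x_ 3 ++ x_ 2) 2).

Section FacePoset.
Variables p1 p2 p3 : nat.

Definition Gamma := presented (Gamma_relator p1 p2 p3).
HB.instance Definition _ := Group.on Gamma.

Definition xG (j : 'I_4) : Gamma := presented_gen (Gamma_relator p1 p2 p3) j.

Definition Gamma_ (j : 'I_4) : set Gamma :=
  gen_subgroup [set xG k | k in [set k | k != j]].

(* Faces of different ranks are different, even when the cosets are equal as
   sets. *)
Inductive face :=
| least_face
| greatest_face
| coset_face (j : 'I_4) (C : right_cosets (Gamma_ j)).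

HB.instance Definition _ := gen_eqMixin face.
HB.instance Definition _ := gen_choiceMixin face.

Definition face_rank (F : face) : int :=
  match F with
  | least_face => -1
  | greatest_face => 4
  | coset_face j _ => j%:Z
  end%R.

Definition face_le (F G : face) : bool :=
  match F, G with
  | least_face, _ => true
  | _, greatest_face => true
  | coset_face j C, coset_face k D =>
      (j <= k)%N && `[< val C `&` val D !=set0 >]
  | _, _ => false
  end.

Lemma of_word_gamma (u v : word 'I_4) :
  of_word (Gamma_relator p1 p2 p3) (u ++ v) =
  (of_word _ u : Gamma) * of_word _ v.
Proof. by rewrite -of_wordM. Qed.

Lemma xG_E (j : 'I_4) : xG j = of_word (Gamma_relator p1 p2 p3) (x_ j).
Proof. by rewrite /x_ inord_val. Qed.

Lemma xG_sqr j : xG j * xG j = 1.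
Proof.
rewrite xG_E -of_word_gamma; apply/of_wordP.
have := word_eq_relator [::] [::] (Gamma_sqr p1 p2 p3 j).
by [].
Qed.

Lemma xGV j : (xG j)^-1 = xG j.
Proof. by apply: (@mulIg _ (xG j)); rewrite mulVg xG_sqr. Qed.

Lemma xG_comm (j k : 'I_4) : (j.+2 <= k)%N -> xG j * xG k = xG k * xG j.
Proof.
move=> jk; have h : xG j * xG k * (xG j * xG k) = 1.
  rewrite !xG_E -!of_word_gamma; apply/of_wordP.
  have jk' : (j.+2 <= k)%N || (k.+2 <= j)%N by rewrite jk.
  have := word_eq_relator [::] [::] (Gamma_comm p1 p2 p3 jk').
  by [].
apply: (@mulIg _ (xG j * xG k)); rewrite h.
by rewrite mulgA -(mulgA (xG k)) xG_sqr mulg1 xG_sqr.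
Qed.

Let lo (k : 'I_4) := gen_subgroup [set xG i | i in [set i : 'I_4 | (i < k)%N]].
Let hi (k : 'I_4) := gen_subgroup [set xG i | i in [set i : 'I_4 | (k < i)%N]].

Lemma lo_sub (k l : 'I_4) : (k <= l)%N -> lo k `<=` Gamma_ l.
Proof.
move=> kl; apply: gen_subgroupS => _ [i /= ik <-]; exists i => //=.
by apply/eqP => il; move: (leq_trans ik kl); rewrite il ltnn.
Qed.

Lemma hi_sub (j k : 'I_4) : (j <= k)%N -> hi k `<=` Gamma_ j.
Proof.
move=> jk; apply: gen_subgroupS => _ [i /= ki <-]; exists i => //=.
by apply/eqP => ij; move: (leq_ltn_trans jk ki); rewrite ij ltnn.
Qed.

Lemma lo_hi_comm k a b : lo k a -> hi k b -> a * b = b * a.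
Proof.
apply: gen_subgroup_comm => _ _ [i /= ik <-] [l /= kl <-].
by apply: xG_comm; exact: leq_ltn_trans ik kl.
Qed.

Lemma Gamma_split k g : Gamma_ k g ->
  exists2 a, lo k a & exists2 b, hi k b & g = a * b.
Proof.
have [slo shi] : is_subgroup (lo k) /\ is_subgroup (hi k).
  by split; exact: gen_subgroupP.
pose L := [set g | exists2 a, lo k a & exists2 b, hi k b & g = a * b].
suff : Gamma_ k `<=` L by apply.
apply: gen_subgroup_min => [|_ [i /= ik <-]].
  split=> [|_ _ [a la [b hb ->]] [a' la' [b' hb' ->]]].
    by exists 1; [exact: slo.1|exists 1; [exact: shi.1|rewrite mulg1]].
  have hbb : hi k (b / b') := shi.2 _ _ hb hb'.
  exists (a / a'); first exact: slo.2.
  exists (b / b') => //; rewrite invgM -!mulgA; congr (_ * _).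
  by rewrite (mulgA b) (lo_hi_comm (is_subgroupV slo la') hbb).
have /orP[ik'|ik'] : (i < k)%N || (k < i)%N by rewrite -neq_ltn.
- exists (xG i); first by apply: sub_gen_subgroup; exists i.
  by exists 1; [exact: shi.1|rewrite mulg1].
- exists 1; first exact: slo.1.
  by exists (xG i); [apply: sub_gen_subgroup; exists i|rewrite mul1g].
Qed.

Lemma Gamma_coset j (C : right_cosets (Gamma_ j)) a b :
  val C a -> val C b <-> Gamma_ j (b / a).
Proof.
have [x _ <-] := set_valP C.
by apply: right_cosetP; exact: gen_subgroupP.
Qed.

Fact face_le_refl : reflexive face_le.
Proof.
case=> //= j C; rewrite leqnn; apply/asboolP.
have [x _ <-] := set_valP C; exists x.
by split; exists 1; rewrite ?mul1g//; apply: (gen_subgroupP _).1.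
Qed.

Fact face_le_anti : antisymmetric face_le.
Proof.
case=> [||j C] [||k D] //= /andP[/andP[jk /asboolP[a [Ca Da]]] /andP[kj _]].
have ejk : j = k by apply/val_inj/eqP; rewrite eqn_leq jk kj.
subst k; congr coset_face; apply/val_inj/seteqP; split=> b.
  by rewrite (Gamma_coset _ Ca) => /(Gamma_coset _ Da).
by rewrite (Gamma_coset _ Da) => /(Gamma_coset _ Ca).
Qed.

Fact face_le_trans : transitive face_le.
Proof.
case=> [||k D] [||j C] [||l E] //= /andP[jk /asboolP[a [Ca Da]]].
move=> /andP[kl /asboolP[b [Db Eb]]]; rewrite (leq_trans jk kl); apply/asboolP.
have := (Gamma_coset _ Da).1 Db => /Gamma_split[u lu [v hv bauv]].
have sG i := @gen_subgroupP Gamma [set xG k | k in [set k | k != i]].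
exists (v * a); split.
  by apply/(Gamma_coset _ Ca); rewrite mulgK; exact: hi_sub hv.
apply/(Gamma_coset _ Eb).
have -> : b = u * v * a by rewrite -bauv mulgVK.
rewrite -(mulgA u) invgM mulgA mulgV mul1g; apply: is_subgroupV (sG l) _.
exact: lo_sub lu.
Qed.

Fact face_display : Order.disp_t. Proof. exact: (Order.Disp tt tt). Qed.

HB.instance Definition _ := Order.Le_isPOrder.Build face_display face
  face_le_refl face_le_anti face_le_trans.

Fact face_le0x F : (least_face <= F)%O. Proof. by []. Qed.
Fact face_lex1 F : (F <= greatest_face)%O. Proof. by case: F. Qed.

HB.instance Definition _ := Order.hasBottom.Build face_display face face_le0x.
HB.instance Definition _ := Order.hasTop.Build face_display face face_lex1.

End FacePoset.

Arguments face_rank p1 p2 p3 F : clear implicits.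

(* Main.v *)
(* Write p2 = 2q with q odd. The relators force <x0 x1, (x1 x2)^2> to be a normal
   abelian subgroup, and since p1 is odd the group embeds into the product
   D(p1) x D(q) x D(p3) of dihedral groups of orders 2 p1, 2 q and 2 p3 through
   the three maps sending (x0, x1, x2, x3) to (a, b, 1, 1), (c, d, c, 1) and
   (1, 1, e, f). A normal form bounds the order from above and these maps bound
   it from below, so the group has order 2 p1 p2 p3. Killing x3, or x2 and x3,
   gives retractions of the group, whence the intersection property of the
   standard subgroups; as in any string C-group, the cosets then form a regular
   polytope whose flags correspond to the group elements. All relators have even
   length, which makes the polytope orientable. *)

From HB Require Import structures.
Require Import Defs.
From mathcomp Require Import all_boot all_order ssralg ssrnum ssrint.
From mathcomp Require Import zmodp zify.
From mathcomp Require Import boolp classical_sets functions cardinality.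

Set Implicit Arguments.
Unset Strict Implicit.
Unset Printing Implicit Defensive.

Import Order.TTheory GRing.Theory.

Local Open Scope classical_set_scope.
Local Open Scope card_scope.
Local Open Scope group_scope.

(** Since [p1] is odd, no endomorphism can kill [x 0] and fix [x 1]: it would give
    [x 1 = x 1 ^+ p1 = 1]. The subgroup on [x 1], [x 2], [x 3] is therefore handled from the other
    side, by retracting onto initial segments of the generators and by splitting off commuting
    factors. Put [s = x 0 * x 1] and [t = (x 1 * x 2) ^+ 2]. The relator [(x0 x1 x2 x1 x2)^2] says
    that [x 0] inverts [t], the relator [(x1 x2 x3 x2)^2] yields that [x 3] commutes with [t], and
    [x 2] conjugates [s] to [s * t]; this is where normality comes from. Orders are bounded below by
    one test: if the generators of a standard subgroup all map to 1 or to one fixed reflection, none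
    of its elements maps to a nontrivial rotation. For [x 2 * x 1], the groups D(p1) and D(p3) only
    see the exponent modulo 2 and D(q) sees it modulo q; as q is odd, the two combine to [2 * q]. *)

Section GroupLemmas.
Variable G : groupType.
Implicit Types (S P : set G) (x y g h : G).

(** Generators being involutions, words without inverses suffice. The property is strengthened to
    invariance of [P], in both directions, under left multiplication by [g]; the elements with this
    property form a subgroup. *)
Lemma gen_subgroup_indl S P : (forall s, S s -> s * s = 1) ->
  P 1 -> (forall s g, S s -> gen_subgroup S g -> P g -> P (s * g)) ->
  gen_subgroup S `<=` P.
Proof.
move=> S2 P1 PS; have sG := @gen_subgroupP G S.
suff : gen_subgroup S `<=`
    [set g | gen_subgroup S g /\
             forall h, gen_subgroup S h -> P h <-> P (g * h)].
  by move=> sub g /sub[_ /(_ 1 sG.1)]; rewrite mulg1 => <-.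
apply: gen_subgroup_min => [|s Ss].
  split=> [|x y [gx Px] [gy Py]]; first split=> [|h].
    - exact: sG.1.
    - by rewrite mul1g.
  split=> [|h gh]; first exact: sG.2.
  have gyh : gen_subgroup S (y^-1 * h).
    exact: is_subgroupM (is_subgroupV sG gy) gh.
  by rewrite -mulgA -(Px _ gyh) (Py _ gyh) mulVKg.
have gs := sub_gen_subgroup Ss; split=> // h gh; split=> [|Psh]; first exact: PS.
rewrite -[h]mul1g -(S2 s Ss) -mulgA; apply: PS => //.
exact: is_subgroupM gs gh.
Qed.

Lemma gen_subgroup_indr S P : (forall s, S s -> s * s = 1) ->
  P 1 -> (forall s g, S s -> gen_subgroup S g -> P g -> P (g * s)) ->
  gen_subgroup S `<=` P.
Proof.
move=> S2 P1 PS g Sg; rewrite -[g]invgK.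
apply: (@gen_subgroup_indl S [set g | P g^-1]) => //=.
- by rewrite invg1.
- move=> s h Ss Sh Ph; rewrite invgM (mulg1_eq (S2 s Ss)).
  by apply: PS => //; apply: is_subgroupV Sh; exact: gen_subgroupP.
- by apply: is_subgroupV Sg; exact: gen_subgroupP.
Qed.

Lemma expgM_swap x y n : (x * y) ^+ n * x = x * (y * x) ^+ n.
Proof.
elim: n => [|n IHn]; first by rewrite mulg1 mul1g.
by rewrite expgS -!mulgA IHn expgS !mulgA.
Qed.

Lemma involM_expgV x y n : x * x = 1 -> y * y = 1 ->
  (y * x) ^+ n = (x * y) ^- n.
Proof.
by move=> x2 y2; rewrite -expVgn invgM (mulg1_eq x2) (mulg1_eq y2).
Qed.

Lemma expg_mod x n m : x ^+ n = 1 -> x ^+ (m %% n) = x ^+ m.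
Proof.
by move=> xn; rewrite {2}(divn_eq m n) expgnDr mulnC expgnA xn expg1n mul1g.
Qed.

(** Keeps all exponents in [nat]: inversion becomes multiplication of the exponent by [n.-1]. *)
Lemma expg_inv x n m : (0 < n)%N -> x ^+ n = 1 -> x ^- m = x ^+ (m * n.-1).
Proof.
case: n => // n _ xn /=; apply: mulg1_eq.
by rewrite -expgnDr -mulnS mulnC expgnA xn expg1n.
Qed.

End GroupLemmas.

(** * Universal property of a presented group (von Dyck) *)

Section PresentedMorphism.
Variables (X : choiceType) (R : set (word X)) (M : groupType) (y : X -> M).

Definition word_val (w : word X) : M :=
  \prod_(a <- w) if a.2 then y a.1 else (y a.1)^-1.

Lemma word_val_cat u v : word_val (u ++ v) = word_val u * word_val v.
Proof. exact: big_cat. Qed.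

Lemma word_val1 k : word_val [:: (k, true)] = y k.
Proof. by rewrite /word_val big_seq1. Qed.

Lemma word_val_pow w n : word_val (wpow w n) = word_val w ^+ n.
Proof.
elim: n => [|n IHn]; first exact: big_nil.
by rewrite /wpow /= word_val_cat IHn expgS.
Qed.

Hypothesis yR : forall r, R r -> word_val r = 1.

Lemma word_val_eq u v : word_eq R u v -> word_val u = word_val v.
Proof.
elim=> {u v} [//|u v _ -> //|u v w _ -> _ -> //|u v k b|u v r Rr].
  rewrite !word_val_cat /word_val big_cons big_seq1 /=.
  by case: b => /=; rewrite ?mulgV ?mulVg mul1g.
by rewrite !word_val_cat (yR Rr) mul1g.
Qed.

Lemma presented_morphism : exists phi : UMagmaMorphism.type (presented R) M,
  forall k, phi (presented_gen R k) = y k.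
Proof.
pose f (g : presented R) := word_val (repr g).
have fM : {morph f : g h / g * h}.
  by move=> g h; rewrite /f (word_val_eq (word_eq_repr _ _)) word_val_cat.
have f1 : f 1 = 1 by apply: (@mulgI _ (f 1)); rewrite -fM !mulg1.
pose fm := isUMagmaMorphism.Build _ _ f (f1, fM).
pose phi : UMagmaMorphism.type (presented R) M := HB.pack f fm.
exists phi => k; rewrite /phi /= /f (word_val_eq (word_eq_repr _ _)).
exact: word_val1.
Qed.

End PresentedMorphism.

(** * Dihedral groups and morphisms out of Gamma *)

Section DihedralGroup.
Variable V : zmodType.

(* [(u, b)] is the isometry [w |-> u + (-1)^b w]. *)
Definition dih : Type := (V * bool)%type.

HB.instance Definition _ := Choice.on dih.

Definition dih_mul (g h : dih) : dih :=
  (if g.2 then g.1 - h.1 else g.1 + h.1, g.2 (+) h.2)%R.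
Definition dih_inv (g : dih) : dih := (if g.2 then g.1 else - g.1, g.2)%R.
Definition dih_one : dih := (0%R, false).

Fact dih_mulA : associative dih_mul.
Proof.
by move=> [u []] [v []] [w []]; rewrite /dih_mul /= ?opprD ?opprK ?addrA.
Qed.

Fact dih_mul1g : left_id dih_one dih_mul.
Proof. by case=> u b; rewrite /dih_mul /= add0r. Qed.

Fact dih_mulg1 : right_id dih_one dih_mul.
Proof. by case=> u []; rewrite /dih_mul /= ?subr0 ?addr0. Qed.

Fact dih_mulVg : left_inverse dih_one dih_inv dih_mul.
Proof. by case=> u []; rewrite /dih_mul /= ?subrr ?addNr. Qed.

Fact dih_mulgV : right_inverse dih_one dih_inv dih_mul.
Proof. by case=> u []; rewrite /dih_mul /= subrr. Qed.

HB.instance Definition _ :=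
  isGroup.Build dih dih_mulA dih_mul1g dih_mulg1 dih_mulVg dih_mulgV.

Definition rotation (u : V) : dih := (u, false).
Definition reflection (u : V) : dih := (u, true).

Lemma mul_reflection u v : reflection u * reflection v = rotation (u - v).
Proof. by []. Qed.

Lemma rotationX u n : rotation u ^+ n = rotation (u *+ n).
Proof.
elim: n => // n IHn; rewrite expgS IHn mulrS.
by [].
Qed.

Lemma reflection_sqr u : reflection u * reflection u = 1.
Proof. by rewrite mul_reflection subrr. Qed.

End DihedralGroup.

Section GammaMorphism.
Variables p1 p2 p3 : nat.
Local Notation Gamma := (Gamma p1 p2 p3).
Local Notation x n := (xG p1 p2 p3 (inord n%N)).

Lemma Gamma_morphism (M : groupType) (y0 y1 y2 y3 : M) :
  y0 * y0 = 1 -> y1 * y1 = 1 -> y2 * y2 = 1 -> y3 * y3 = 1 ->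
  (y0 * y1) ^+ p1 = 1 -> (y1 * y2) ^+ p2 = 1 -> (y2 * y3) ^+ p3 = 1 ->
  commute y0 y2 -> commute y0 y3 -> commute y1 y3 ->
  (y0 * (y1 * (y2 * (y1 * y2)))) ^+ 2 = 1 ->
  (y1 * (y2 * (y3 * y2))) ^+ 2 = 1 ->
  exists phi : UMagmaMorphism.type Gamma M,
    forall j : nat, (j < 4)%N -> phi (x j) = nth 1 [:: y0; y1; y2; y3] j.
Proof.
move=> y02 y12 y22 y32 h1 h2 h3 c02 c03 c13 r1 r2.
pose y := nth 1 [:: y0; y1; y2; y3].
have yy j : y j * y j = 1.
  by move: j => [|[|[|[|j]]]] //=; rewrite /y /= nth_nil mulg1.
have sqr_comm a b : commute (y a) (y b) -> (y a * y b) ^+ 2 = 1.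
  by move=> cab; rewrite expgMn // !expg2 !yy mulg1.
have valx j : (j < 4)%N -> word_val (fun k : 'I_4 => y k) (x_ j) = y j.
  by move=> j4; rewrite word_val1 inordK.
have valX (j : 'I_4) : word_val (fun k : 'I_4 => y k) (x_ j) = y j.
  exact: valx.
have [|phi phiE] := @presented_morphism _ (Gamma_relator p1 p2 p3) M
    (fun k : 'I_4 => y k); last first.
  by exists phi => j j4; rewrite phiE inordK.
move=> _ [j||||j k jk||]; rewrite word_val_pow ?word_val_cat ?valX ?valx //.
  by rewrite expg2 yy.
case: j k jk => [[|[|[|[|j]]]] j4] [[|[|[|[|k]]]] k4] //= _;
  by apply: sqr_comm => //; apply: commute_sym.
Qed.

Lemma of_word_val (w : word 'I_4) :
  of_word (Gamma_relator p1 p2 p3) w = word_val (@xG p1 p2 p3) w :> Gamma.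
Proof.
elim: w => [|[k b] w IHw]; first by rewrite /word_val big_nil.
rewrite -cat1s of_word_gamma IHw word_val_cat; congr (_ * _).
rewrite /word_val big_seq1 /=; case: b => //; apply/esym/mulg1_eq.
rewrite -of_word_gamma; apply/of_wordP.
exact: (word_eq_cancel _ [::] [::] k true).
Qed.

Lemma Gamma_relation r : Gamma_relator p1 p2 p3 r ->
  word_val (@xG p1 p2 p3) r = 1.
Proof.
move=> Rr; rewrite -of_word_val; apply/of_wordP.
by have := word_eq_relator [::] [::] Rr; rewrite cats0.
Qed.

Lemma x_p1 : (x 0 * x 1) ^+ p1 = 1.
Proof.
by have := Gamma_relation (Gamma_p1 p1 p2 p3);
  rewrite word_val_pow word_val_cat !word_val1.
Qed.

Lemma x_p2 : (x 1 * x 2) ^+ p2 = 1.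
Proof.
by have := Gamma_relation (Gamma_p2 p1 p2 p3);
  rewrite word_val_pow word_val_cat !word_val1.
Qed.

Lemma x_p3 : (x 2 * x 3) ^+ p3 = 1.
Proof.
by have := Gamma_relation (Gamma_p3 p1 p2 p3);
  rewrite word_val_pow word_val_cat !word_val1.
Qed.

Lemma x_01212 : (x 0 * (x 1 * (x 2 * (x 1 * x 2)))) ^+ 2 = 1.
Proof.
by have := Gamma_relation (Gamma_01212 p1 p2 p3);
  rewrite word_val_pow !word_val_cat !word_val1.
Qed.

Lemma x_1232 : (x 1 * (x 2 * (x 3 * x 2))) ^+ 2 = 1.
Proof.
by have := Gamma_relation (Gamma_1232 p1 p2 p3);
  rewrite word_val_pow !word_val_cat !word_val1.
Qed.

Lemma x_comm j k : (j.+2 <= k < 4)%N -> commute (x j) (x k).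
Proof. by move=> jk; apply: xG_comm; rewrite !inordK //; lia. Qed.

Lemma xK j g : x j * (x j * g) = g.
Proof. by rewrite mulgA xG_sqr mul1g. Qed.

End GammaMorphism.

(** * Standard subgroups *)

Section Subgroups.
Variables p1 p2 p3 : nat.
Local Notation Gamma := (Gamma p1 p2 p3).
Local Notation x n := (xG p1 p2 p3 (inord n%N)).
Implicit Types (A B : pred nat) (g h : Gamma).

Definition gsub A : set Gamma :=
  gen_subgroup [set xG p1 p2 p3 k | k in [set k : 'I_4 | A k]].

Lemma gsubP A : is_subgroup (gsub A). Proof. exact: gen_subgroupP. Qed.

Lemma gsub1 A : gsub A 1. Proof. by case: (gsubP A). Qed.

Lemma gsubM A g h : gsub A g -> gsub A h -> gsub A (g * h).
Proof. by apply: is_subgroupM; exact: gsubP. Qed.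

Lemma gsubV A g : gsub A g -> gsub A g^-1.
Proof. by apply: is_subgroupV; exact: gsubP. Qed.

Lemma gsubX A g n : gsub A g -> gsub A (g ^+ n).
Proof.
by move=> Ag; elim: n => [|n IHn]; [exact: gsub1 | rewrite expgS; exact: gsubM].
Qed.

Lemma gsub_gen A j : (j < 4)%N -> A j -> gsub A (x j).
Proof.
by move=> j4 Aj; apply: sub_gen_subgroup; exists (inord j); rewrite //= inordK.
Qed.

Lemma gsub_indl A (P : set Gamma) : P 1 ->
  (forall j g, (j < 4)%N -> A j -> gsub A g -> P g -> P (x j * g)) ->
  gsub A `<=` P.
Proof.
move=> P1 PS; apply: gen_subgroup_indl => // [_ [j _ <-]|_ g [j Aj <-]].
  exact: xG_sqr.
by rewrite -[j]inord_val; apply: PS.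
Qed.

Lemma gsub_indr A (P : set Gamma) : P 1 ->
  (forall j g, (j < 4)%N -> A j -> gsub A g -> P g -> P (g * x j)) ->
  gsub A `<=` P.
Proof.
move=> P1 PS; apply: gen_subgroup_indr => // [_ [j _ <-]|_ g [j Aj <-]].
  exact: xG_sqr.
by rewrite -[j]inord_val; apply: PS.
Qed.

Lemma gsubS A B : (forall j, (j < 4)%N -> A j -> B j) -> gsub A `<=` gsub B.
Proof.
move=> AB; apply: gsub_indl => [|j g j4 Aj _ Bg]; first exact: gsub1.
by apply: gsubM => //; apply: gsub_gen => //; exact: AB.
Qed.

Lemma gsubT A g : (forall j, (j < 4)%N -> A j) -> gsub A g.
Proof.
move=> Aall; rewrite -[g]of_word_repr of_word_val.
elim: (repr g) => [|[k b] w IHw]; first by rewrite /word_val big_nil; exact: gsub1.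
rewrite -cat1s word_val_cat; apply: gsubM => //.
have Ak : gsub A (xG p1 p2 p3 k) 
  by rewrite -[k]inord_val; apply: gsub_gen => //; exact: Aall.
by rewrite /word_val big_seq1; case: b => //=; exact: gsubV.
Qed.

Lemma commute_gsub A g h :
  (forall j, (j < 4)%N -> A j -> commute g (x j)) -> gsub A h -> commute g h.
Proof.
move=> gA; move: h; apply: gsub_indl => [|j h j4 Aj _ gh]; first exact: commute1.
by apply: commuteM => //; exact: gA.
Qed.

Lemma x_commute j k : (j < 4)%N -> (k < 4)%N -> (j.+1 != k) -> (k.+1 != j) ->
  commute (x j) (x k).
Proof.
move=> j4 k4 jk kj; have [->|njk] := eqVneq j k; first exact: commute_refl.
have [lt|le] := ltnP j k; first by apply: x_comm; lia.
by apply/commute_sym/x_comm; lia.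
Qed.

(** Generators with index below [m] commute with those above, so removing [m] from the string leaves
    two commuting factors. *)
Lemma gsub_split A m g : ~~ A m -> gsub A g ->
  exists u v, [/\ gsub [pred k | A k & (k < m)%N] u,
                  gsub [pred k | A k & (m < k)%N] v & g = u * v].
Proof.
move=> nAm; move: g; apply: gsub_indl => [|j g j4 Aj _ [u [v [Hu Hv ->]]]].
  by exists 1, 1; split; rewrite ?mulg1 //; exact: gsub1.
have [jm|mj|jm] := ltngtP j m; last by rewrite jm (negPf nAm) in Aj.
  exists (x j * u), v; split; rewrite ?mulgA //.
  by apply: gsubM => //; apply: gsub_gen; rewrite //= Aj.
exists u, (x j * v); split=> //.
  by apply: gsubM => //; apply: gsub_gen; rewrite //= Aj.
rewrite !mulgA; congr (_ * _).
by apply: commute_gsub Hu => k k4 /andP[_ km]; apply: x_commute; lia.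
Qed.

(** A membership test: the image of [gsub A] has at most two elements, so an element with any other
    image lies outside [gsub A]. *)
Lemma gsub_pair (M : groupType) (phi : UMagmaMorphism.type Gamma M) (r : M) A g :
  r * r = 1 -> (forall j, (j < 4)%N -> A j -> phi (x j) = 1 \/ phi (x j) = r) ->
  gsub A g -> phi g = 1 \/ phi g = r.
Proof.
move=> r2 Ar; move: g; apply: gsub_indl => [|j g j4 Aj _ IH].
  by left; exact: gmulf1.
rewrite gmulfM; case: (Ar j j4 Aj) IH => -> [] ->; rewrite ?r2 ?mulg1 ?mul1g; auto.
Qed.

Definition retractable A := exists phi : UMagmaMorphism.type Gamma Gamma,
  forall j : nat, (j < 4)%N -> phi (x j) = if A j then x j else 1.

Lemma retract_id A (phi : UMagmaMorphism.type Gamma Gamma) g :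
  (forall j : nat, (j < 4)%N -> phi (x j) = if A j then x j else 1) ->
  gsub A g -> phi g = g.
Proof.
move=> phiE; move: g; apply: gsub_indl => [|j g j4 Aj _ IH]; first exact: gmulf1.
by rewrite gmulfM IH phiE // Aj.
Qed.

(* A retraction onto [gsub A] that kills the other generators maps [gsub B]
   into [gsub (A :&: B)] and fixes the elements of [gsub A]. *)
Lemma retract_cap A B g : retractable A -> gsub A g -> gsub B g ->
  gsub [pred k | A k & B k] g.
Proof.
move=> [phi phiE] Ag Bg; rewrite -(retract_id phiE Ag).
move: g Bg {Ag}; apply: gsub_indl => [|j g j4 Bj _ IH].
  by rewrite gmulf1; exact: gsub1.
rewrite gmulfM phiE //; case: ifP => Aj; last by rewrite mul1g.
by apply: gsubM => //; apply: gsub_gen; rewrite //= Aj.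
Qed.

End Subgroups.

(** The witness is an ordinal type rather than ['Z_n] because [q = 1] is allowed and ['Z_1] has two
    elements. *)
Lemma cyclic_zmodType n : (0 < n)%N ->
  exists (V : zmodType) (v : V), forall m, (v *+ m == 0)%R = (n %| m)%N.
Proof.
case: n => // n _; exists 'I_n.+1, (inZp 1) => m.
by rewrite Zp_mulrn /dvdn -val_eqE /= modnMml mul1n.
Qed.

Lemma invol_expg_even (G : groupType) (y : G) n : y * y = 1 -> ~~ odd n ->
  y ^+ n = 1.
Proof.
by move=> y2 en; rewrite -(even_halfK en) -mul2n expgnA expg2 y2 expg1n.
Qed.

Lemma invol_expg_odd (G : groupType) (y : G) n : y * y = 1 -> odd n ->
  y ^+ n = y.
Proof. by case: n => // n y2 on; rewrite expgS invol_expg_even ?mulg1. Qed.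

(** * Retractions and dihedral images of Gamma *)

Section Orders.
Variables p1 q p3 : nat.
Local Notation Gamma := (Gamma p1 (2 * q) p3).
Local Notation x n := (xG p1 (2 * q) p3 (inord n%N)).
Local Notation gsub := (@gsub p1 (2 * q) p3).

Hypothesis p3_even : ~~ odd p3.

Let p2_even : ~~ odd (2 * q). Proof. by rewrite mul2n odd_double. Qed.

(** Once [x 3] is sent to 1, the relator [(x2 x3)^p3] becomes [x2^p3], which is trivial because [p3]
    is even. *)
Lemma retract012 : @retractable p1 (2 * q) p3 [pred k | k < 3]%N.
Proof.
have xx j := @xG_sqr p1 (2 * q) p3 j; have x1x := invol_expg_even (xx _).
have [||||||||||||phi phiE] := @Gamma_morphism p1 (2 * q) p3 _ (x 0) (x 1) (x 2) 1;
  last by exists phi => -[|[|[|[|j]]]] // j4; rewrite phiE.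
all: rewrite ?mul1g ?mulg1 ?xx ?mulg1 ?x1x //.
- exact: x_p1.
- exact: x_p2.
- exact: x_comm.
- exact: commute1.
- exact: commute1.
- exact: x_01212.
Qed.

(** Here the evenness of [2 * q] disposes of [(x1 x2)^(2q)], which becomes a power of [x 1]. *)
Lemma retract01 : @retractable p1 (2 * q) p3 [pred k | k < 2]%N.
Proof.
have xx j := @xG_sqr p1 (2 * q) p3 j; have x1x := invol_expg_even (xx _).
have [||||||||||||phi phiE] := @Gamma_morphism p1 (2 * q) p3 _ (x 0) (x 1) 1 1;
  last by exists phi => -[|[|[|[|j]]]] // j4; rewrite phiE.
all: rewrite ?mul1g ?mulg1 ?expg1n ?xx ?mulg1 ?x1x //.
- exact: x_p1.
- exact: commute1.
- exact: commute1.
- exact: commute1.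
Qed.

Section DihedralImages.
Variables (V : zmodType) (v : V) (n : nat).
Hypothesis vn : forall m, (v *+ m == 0)%R = (n %| m)%N.

Let vX m : (n %| m)%N -> rotation v ^+ m = 1.
Proof. by rewrite rotationX -vn => /eqP->. Qed.

Let vVX m : (n %| m)%N -> rotation (0 - v)%R ^+ m = 1.
Proof. by rewrite rotationX sub0r mulNrn -vn => /eqP->; rewrite oppr0. Qed.

Let r0 := reflection (0 : V)%R.
Let rv := reflection v.

Let rr0 : r0 * r0 = 1. Proof. exact: reflection_sqr. Qed.
Let rrv : rv * rv = 1. Proof. exact: reflection_sqr. Qed.
Let even0 m := @invol_expg_even _ r0 m rr0.
Let evenv m := @invol_expg_even _ rv m rrv.

Lemma dihedral_image01 : (n %| p1)%N ->
  exists phi : UMagmaMorphism.type Gamma (dih V),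
    forall j : nat, (j < 4)%N -> phi (x j) = nth 1 [:: r0; rv; 1; 1] j.
Proof.
move=> np; apply: Gamma_morphism;
  rewrite ?mul1g ?mulg1 ?expg1n ?rr0 ?rrv ?mulg1 ?expg1n ?even0 ?evenv //.
- by rewrite mul_reflection vVX.
- exact: commute1.
- exact: commute1.
- exact: commute1.
Qed.

Lemma dihedral_image23 : (n %| p3)%N ->
  exists phi : UMagmaMorphism.type Gamma (dih V),
    forall j : nat, (j < 4)%N -> phi (x j) = nth 1 [:: 1; 1; r0; rv] j.
Proof.
move=> np; apply: Gamma_morphism;
  rewrite ?mul1g ?mulg1 ?expg1n ?rr0 ?rrv ?mulg1 ?expg1n ?even0 ?evenv //.
- by rewrite mul_reflection vVX.
- exact/commute_sym/commute1.
- exact/commute_sym/commute1.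
- exact/commute_sym/commute1.
- exact: reflection_sqr.
Qed.

(** The word [x0 x1 x2 x1 x2] maps to the alternating product of five reflections [r0], [rv], [r0],
    [rv], [r0]. This is again a reflection, so its square is 1. *)
Lemma dihedral_image012 : (n %| p1)%N -> (n %| q)%N ->
  exists phi : UMagmaMorphism.type Gamma (dih V),
    forall j : nat, (j < 4)%N -> phi (x j) = nth 1 [:: r0; rv; r0; 1] j.
Proof.
move=> np nq; apply: Gamma_morphism;
  rewrite ?mul1g ?mulg1 ?expg1n ?rr0 ?rrv ?mulg1 ?expg1n ?even0 ?evenv //.
- by rewrite mul_reflection vVX.
- by rewrite mul_reflection subr0 vX // dvdn_mull.
- exact: commute1.
- exact: commute1.
- exact: reflection_sqr.
Qed.

(** The parity of word length, with values in the subgroup [{1, r0}]. *)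
Lemma sign_image : 
  exists phi : UMagmaMorphism.type Gamma (dih V),
    forall j : nat, (j < 4)%N -> phi (x j) = r0.
Proof.
have [||||||||||||phi phiE] := @Gamma_morphism p1 (2 * q) p3 _ r0 r0 r0 r0;
  last by exists phi => -[|[|[|[|j]]]] // j4; rewrite phiE.
all: by [exact: commute_refl | exact: reflection_sqr
        | rewrite ?rr0 ?mulg1 ?rr0 ?expg1n].
Qed.

End DihedralImages.

End Orders.

(** * Rotations in standard subgroups and the intersection property *)

Section GammaStructure.
Variables p1 q p3 : nat.
Local Notation Gamma := (Gamma p1 (2 * q) p3).
Local Notation x n := (xG p1 (2 * q) p3 (inord n%N)).
Local Notation gsub := (@gsub p1 (2 * q) p3).

(* The face of rank [l - 1] containing the identity is [Gr l]; [Gr 0] and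
   [Gr 5] are the whole group. *)
Definition Gr (l : nat) : set Gamma := gsub [pred k | k.+1 != l].

Lemma Gr0 g : Gr 0 g. Proof. exact: gsubT. Qed.

Lemma Gr_ge5 l g : (4 < l)%N -> Gr l g.
Proof. by move=> l4; apply: gsubT => j j4 /=; lia. Qed.

Lemma x_in_Gr j l : (j < 4)%N -> j.+1 != l -> Gr l (x j).
Proof. by move=> j4 jl; exact: gsub_gen. Qed.

Hypotheses (p1_gt2 : (2 < p1)%N) (p1_odd : odd p1) (q_dvd : (q %| p1)%N).
Hypotheses (p3_gt0 : (0 < p3)%N) (p3_even : ~~ odd p3).

Let p1_gt0 : (0 < p1)%N. Proof. exact: ltn_trans p1_gt2. Qed.
Let q_gt0 : (0 < q)%N. Proof. exact: dvdn_gt0 q_dvd. Qed.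
Let q_odd : odd q. Proof. exact: dvdn_odd q_dvd p1_odd. Qed.
Let p3_gt1 : (1 < p3)%N. Proof. by case: p3 p3_gt0 p3_even => [|[]]. Qed.

Definition period (l : nat) : nat := nth 0%N [:: p1; (2 * q)%N; p3] l.

Lemma rotation_reflection (V : zmodType) (u w : V) :
  rotation u = 1 \/ rotation u = reflection w -> u = 0%R.
Proof. by case=> // -[]. Qed.

(** In D(p1) the image of [Gr l] is generated by one reflection, while [x 1 * x 0] becomes a
    rotation of order [p1]. *)
Lemma Gr_rotation0 m l : (l == 1%N) || (l == 2%N) ->
  Gr l ((x 1 * x 0) ^+ m) -> (p1 %| m)%N.
Proof.
move=> hl; have [V [v vn]] := cyclic_zmodType p1_gt0.
have [phi phiE] := dihedral_image01 q p3 vn (dvdnn p1).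
have phiX : phi ((x 1 * x 0) ^+ m) = rotation (v *+ m)%R.
  by rewrite gmulfXn gmulfM !phiE //= mul_reflection subr0 rotationX.
(* [Gr 1] lacks [x 0] and retains the reflection [v]; [Gr 2] lacks [x 1] and retains the reflection
   0. *)
move=> /(@gsub_pair _ _ _ _ phi (reflection (if l == 1%N then v else 0%R))).
rewrite phiX -vn => H; apply/eqP/rotation_reflection/H.
  exact: reflection_sqr.
move=> [|[|[|[|j]]]] //= _; rewrite phiE //=; auto;
  case/orP: hl => /eqP-> //=; auto.
Qed.

Lemma Gr_rotation2 m l : (l == 3%N) || (l == 4%N) ->
  Gr l ((x 3 * x 2) ^+ m) -> (p3 %| m)%N.
Proof.
move=> hl; have [V [v vn]] := cyclic_zmodType p3_gt0.
have [phi phiE] := dihedral_image23 p1 q vn (dvdnn p3).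
have phiX : phi ((x 3 * x 2) ^+ m) = rotation (v *+ m)%R.
  by rewrite gmulfXn gmulfM !phiE //= mul_reflection subr0 rotationX.
move=> /(@gsub_pair _ _ _ _ phi (reflection (if l == 3%N then v else 0%R))).
rewrite phiX -vn => H; apply/eqP/rotation_reflection/H.
  exact: reflection_sqr.
move=> [|[|[|[|j]]]] //= _; rewrite phiE //=; auto;
  case/orP: hl => /eqP-> //=; auto.
Qed.


(** An odd power of [x 2 * x 1] maps to the reflection that the image of [Gr l] misses: that of
    [x 1] in D(p1) for [l = 2], that of [x 2] in D(p3) for [l = 3]. *)
Lemma Gr_rotation1_odd m l : (l == 2%N) || (l == 3%N) ->
  Gr l ((x 2 * x 1) ^+ m) -> ~~ odd m.
Proof.
move=> hl Hm; apply/negP => om; case/orP: hl Hm => /eqP->.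
- have [V [v vn]] := cyclic_zmodType p1_gt0.
  have [phi phiE] := dihedral_image01 q p3 vn (dvdnn p1).
  move=> /(@gsub_pair _ _ _ _ phi (reflection 0%R)).
  rewrite gmulfXn gmulfM !phiE //= mul1g invol_expg_odd ?reflection_sqr //.
  have : v != 0%R by rewrite -[v]mulr1n vn gtnNdvd // ltnW.
  move=> /eqP v0 []//; last by case.
  by move=> [|[|[|[|j]]]] //= _; rewrite phiE //=; auto.
- have [V [v vn]] := cyclic_zmodType p3_gt0.
  have [phi phiE] := dihedral_image23 p1 q vn (dvdnn p3).
  move=> /(@gsub_pair _ _ _ _ phi (reflection v)).
  rewrite gmulfXn gmulfM !phiE //= mulg1 invol_expg_odd ?reflection_sqr //.
  have : v != 0%R by rewrite -[v]mulr1n vn gtnNdvd.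
  move=> /eqP v0 []//; last by case=> /esym.
  by move=> [|[|[|[|j]]]] //= _; rewrite phiE //=; auto.
Qed.

Lemma Gr_rotation1 m l : (l == 2%N) || (l == 3%N) ->
  Gr l ((x 2 * x 1) ^+ m) -> (2 * q %| m)%N.
Proof.
move=> hl Hm; have em := Gr_rotation1_odd hl Hm.
rewrite Gauss_dvd; last by rewrite coprime2n.
rewrite dvdn2 em /=; have [V [v vn]] := cyclic_zmodType q_gt0.
have [phi phiE] := dihedral_image012 p3_even vn q_dvd (dvdnn q).
have phiX : phi ((x 2 * x 1) ^+ m) = rotation ((0 - v) *+ m)%R.
  by rewrite gmulfXn gmulfM !phiE //= mul_reflection rotationX.
suff : rotation ((0 - v) *+ m)%R = 1 \/
       rotation ((0 - v) *+ m)%R = reflection (0 : V)%R.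
  by move/rotation_reflection/eqP; rewrite sub0r mulNrn oppr_eq0 vn.
rewrite -phiX; case/orP: hl Hm => /eqP->.
  apply: gsub_pair; first exact: reflection_sqr.
  by move=> [|[|[|[|j]]]] //= _; rewrite phiE //=; auto.
(* [Gr 3] contains [x 0] and [x 1], which generate the whole dihedral image, so the two-element test
   fails. Instead the power is shown to lie in the subgroup on [x 0], [x 1]; the retraction onto it
   fixes the power and also sends it to [x 1 ^+ m], which is 1 as [m] is even. *)
move=> H3; have /(retract_cap (retract012 p1 q p3_even)) /(_ H3) H01 :
    gsub [pred k | k < 3]%N ((x 2 * x 1) ^+ m).
  by apply: gsubX; apply: gsubM; exact: gsub_gen.
have [psi psiE] := retract01 p1 q p3.
have {}H01 : gsub [pred k | k < 2]%N ((x 2 * x 1) ^+ m).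
  by apply: gsubS H01 => j j4 /=; lia.
left; rewrite -(retract_id psiE H01) gmulfXn gmulfM !psiE //= mul1g.
by rewrite invol_expg_even ?gmulf1 // xG_sqr.
Qed.

Lemma Gr_rotation j l m : (j < 3)%N -> (l == j.+1) || (l == j.+2) ->
  Gr l ((x j.+1 * x j) ^+ m) -> (period j %| m)%N.
Proof.
case: j => [|[|[|j]]] // _; [exact: Gr_rotation0 | exact: Gr_rotation1 |].
exact: Gr_rotation2.
Qed.

Lemma period_gt1 j : (j < 3)%N -> (1 < period j)%N.
Proof. by rewrite /period; case: j => [|[|[|j]]] //= _; lia. Qed.

Lemma period_expg j : (j < 3)%N -> (x j.+1 * x j) ^+ period j = 1.
Proof.
move=> j3; rewrite involM_expgV ?xG_sqr //.
suff -> : (x j * x j.+1) ^+ period j = 1 by rewrite invg1.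
by case: j j3 => [|[|[|j]]] // _; [exact: x_p1 | exact: x_p2 | exact: x_p3].
Qed.

(** Otherwise a rotation formed with a neighbouring generator would lie in [Gr j.+1], and its period
    would divide 1. *)
Lemma x_notin_Gr j : (j < 4)%N -> ~ Gr j.+1 (x j).
Proof.
move=> j4 H; have [j3|j3] := ltnP j 3.
  have /Gr_rotation : Gr j.+1 ((x j.+1 * x j) ^+ 1).
    by apply: gsubM H; apply: x_in_Gr => //; lia.
  by rewrite eqxx dvdn1 => /(_ j3 isT); have := period_gt1 j3; lia.
have {}j3 : j = 3%N by lia.
rewrite {}j3 in H; have /Gr_rotation : Gr 4 ((x 3 * x 2) ^+ 1).
  by apply: gsubM => //; apply: x_in_Gr.
by move=> /(_ isT isT); rewrite dvdn1 /period /=; lia.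
Qed.

Lemma Gr_cap4 l g : Gr l g -> Gr 4 g ->
  gsub [pred k | k.+1 != l & k.+1 != 4]%N g.
Proof.
move=> Hl H4; have H3 : gsub [pred k | k < 3]%N g.
  by apply: gsubS H4 => j /= j4; lia.
apply: gsubS (retract_cap (retract012 p1 q p3_even) H3 Hl) => j j4 /=; lia.
Qed.

(** Neither subgroup is the image of one of the two retractions. Splitting an element of [Gr 3] at
    the missing [x 2] gives [u * v] with [v] a power of [x 3]; as [v] is in [Gr 1], so is [u], and
    [u] can be retracted within the subgroup on [x 0], [x 1]. *)
Lemma Gr_cap13 g : Gr 1 g -> Gr 3 g -> gsub [pred k | k.+1 != 1 & k.+1 != 3]%N g.
Proof.
move=> H1 H3; have n2 : ~~ [pred k | k.+1 != 3]%N 2 by [].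
have [u [v [Hu Hv gE]]] := gsub_split n2 H3.
rewrite gE in H1 *.
have Hu2 : gsub [pred k | k < 2]%N u by apply: gsubS Hu => j j4 /=; lia.
have {}H1 : Gr 1 u.
  rewrite -[u](mulgK v); apply: gsubM H1 _; apply: gsubV.
  by apply: gsubS Hv => j j4 /=; lia.
apply: gsubM; last by apply: gsubS Hv => j j4 /=; lia.
by apply: gsubS (retract_cap (retract01 p1 q p3) Hu2 H1) => j j4 /=; lia.
Qed.

(** The pairs [l], [m] are the levels that bound a section of rank at least 1, improper faces
    included. *)
Lemma Gr_cap l m g : (l.+1 < m <= 5)%N -> Gr l g -> Gr m g ->
  gsub [pred k | k.+1 != l & k.+1 != m] g.
Proof.
move=> lm Hl Hm; have [l0|l0] := posnP l.
  by apply: gsubS Hm => j j4 /=; lia.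
have [m5|m5] := eqVneq m 5; first by apply: gsubS Hl => j j4 /=; lia.
have [m4|m4] := eqVneq m 4; first by rewrite m4 in Hm *; exact: Gr_cap4.
have [l1 m3] : l = 1%N /\ m = 3%N by split; lia.
by rewrite l1 m3 in Hl Hm *; exact: Gr_cap13.
Qed.

(** This gives each flag a single group element. [Gr 4], [Gr 3] and [Gr 1] together leave only 1 and
    [x 1], and [Gr 2] excludes [x 1]. *)
Lemma Gr_trivial g : (forall l, (0 < l < 5)%N -> Gr l g) -> g = 1.
Proof.
move=> H; have H3 := retract_cap (retract012 p1 q p3_even) _ (H 3 isT).
have {}H3 : gsub [pred k | k < 2]%N g.
  have /H3 : gsub [pred k | k < 3]%N g by apply: gsubS (H 4 isT) => j j4 /=; lia.
  by apply: gsubS => j j4 /=; lia.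
have {}H3 := retract_cap (retract01 p1 q p3) H3 (H 1%N isT).
suff : g = 1 \/ g = x 1.
  by case=> // gx; case: (@x_notin_Gr 1) => //; rewrite -gx; apply: H.
move: g H3 {H}; apply: gsub_indl => [|j g j4 /= Aj _]; first by left.
have -> : j = 1%N by lia.
by case=> ->; rewrite ?mulg1 ?xG_sqr; auto.
Qed.

(** The group side of the diamond condition: the remaining generators are [x l] and others that
    commute with it and lie in [Gr l.+1]. *)
Lemma Gr_cap_gen1 l g : (l < 4)%N -> Gr l g -> Gr l.+2 g ->
  Gr l.+1 g \/ Gr l.+1 (g * x l).
Proof.
move=> l4 Hl Hm; have : gsub [pred k | k.+1 != l & k.+1 != l.+2] g.
  by apply: Gr_cap => //; lia.
move: g {Hl Hm}; apply: gsub_indr => [|j g j4 /= Aj _].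
  by left; exact: gsub1.
have [->|jl] := eqVneq j l.
  by rewrite -mulgA xG_sqr mulg1 => -[]; auto.
have Hj : Gr l.+1 (x j) by apply: x_in_Gr => //; lia.
case=> H; [left | right]; first exact: gsubM.
have c : commute (x j) (x l) by apply: x_commute; lia.
by rewrite -mulgA c mulgA; exact: gsubM.
Qed.

(** The group side of the polygonal sections: [h] collects the generators commuting with both [x l]
    and [x l.+1], and the rest is an element of the dihedral group on these two. *)
Lemma Gr_cap_gen2 l g : (l < 3)%N -> Gr l g -> Gr l.+3 g ->
  exists h i, [/\ Gr l.+1 h, Gr l.+2 h &
    g = h * (x l.+1 * x l) ^+ i \/ g = h * x l * (x l.+1 * x l) ^+ i].
Proof.
move=> l3 Hl Hm; have : gsub [pred k | k.+1 != l & k.+1 != l.+3] g.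
  by apply: Gr_cap => //; lia.
set s := x l.+1 * x l; have sn := period_expg l3.
have pgt0 : (0 < period l)%N by apply: ltnW; exact: period_gt1.
(* [x l] inverts [s]; the new exponent is [-i] modulo the period. *)
have sx i : s ^+ i * x l = x l * s ^+ (i * (period l).-1).
  rewrite -expg_inv // -involM_expgV ?xG_sqr // /s.
  apply: (@mulgI _ (x l)); rewrite xK mulgA -expgM_swap.
  by rewrite -mulgA xG_sqr mulg1.
have step g0 : (exists h i, [/\ Gr l.+1 h, Gr l.+2 h &
    g0 = h * s ^+ i \/ g0 = h * x l * s ^+ i]) ->
    exists h i, [/\ Gr l.+1 h, Gr l.+2 h &
    g0 * x l = h * s ^+ i \/ g0 * x l = h * x l * s ^+ i].
  move=> [h [i [H1 H2 gE]]]; exists h, (i * (period l).-1)%N; split=> //.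
  case: gE => ->; rewrite -mulgA sx mulgA; first by right.
  by left; rewrite -(mulgA h) xG_sqr mulg1.
move: g {Hl Hm}; apply: gsub_indr => [|j g j4 /= Aj _ IH].
  by exists 1, 0%N; split; [exact: gsub1 | exact: gsub1 | left; rewrite mulg1].
have [->|jl] := eqVneq j l; first exact: step.
have [->|jl1] := eqVneq j l.+1.
  (* Multiplying by [x l.+1] is thus a shift of the exponent followed by the case of [x l]. *)
  have -> : x l.+1 = s * x l by rewrite /s -mulgA xG_sqr mulg1.
  rewrite mulgA; apply: step.
  case: IH => [h [i [H1 H2 gE]]]; exists h, i.+1; split=> //.
  by rewrite expgSr !mulgA; case: gE => ->; auto.
case: IH => [h [i [H1 H2 gE]]]; exists (h * x j), i; split.
- by apply: gsubM => //; apply: x_in_Gr => //; lia.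
- by apply: gsubM => //; apply: x_in_Gr => //; lia.
have c0 : commute (x j) (x l) by apply: x_commute; lia.
have c1 : commute (x j) (s ^+ i).
  by apply: commuteX; apply: commuteM => //; apply: x_commute; lia.
case: gE => ->; [left | right].
  by rewrite -!mulgA c1.
by rewrite -!mulgA -c1 !mulgA -(mulgA h) -c0 !mulgA.
Qed.

End GammaStructure.

(** * The order of Gamma *)

Lemma mulrn_inj_order (V : zmodType) (v : V) n :
  (forall m, (v *+ m == 0)%R = (n %| m)%N) ->
  forall a b, (a < n)%N -> (b < n)%N -> (v *+ a = v *+ b)%R -> a = b.
Proof.
move=> vn a b; wlog ab : a b / (a <= b)%N.
  by move=> H an bn e; case/orP: (leq_total a b) => le; [|apply/esym]; apply: H.
move=> an bn e; have : (v *+ (b - a) == 0)%R by rewrite mulrnBr // e subrr.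
by rewrite vn => /dvdn_leq; lia.
Qed.

Section GammaOrder.
Variables p1 q p3 : nat.
Local Notation Gamma := (Gamma p1 (2 * q) p3).
Local Notation x n := (xG p1 (2 * q) p3 (inord n%N)).

Hypotheses (p1_gt2 : (2 < p1)%N) (p1_odd : odd p1) (q_dvd : (q %| p1)%N).
Hypotheses (p3_gt0 : (0 < p3)%N) (p3_even : ~~ odd p3).

Let p1_gt0 : (0 < p1)%N. Proof. exact: ltn_trans p1_gt2. Qed.
Let q_gt0 : (0 < q)%N. Proof. exact: dvdn_gt0 q_dvd. Qed.
Let q_odd : odd q. Proof. exact: dvdn_odd q_dvd p1_odd. Qed.

Let s : Gamma := x 0 * x 1.
Let t : Gamma := (x 1 * x 2) ^+ 2.
Let r : Gamma := x 3 * x 2.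

Let s_p1 : s ^+ p1 = 1. Proof. exact: x_p1. Qed.
Let t_q : t ^+ q = 1. Proof. by rewrite /t -expgnA x_p2. Qed.
Let r_p3 : r ^+ p3 = 1.
Proof. by rewrite /r involM_expgV ?xG_sqr // x_p3 invg1. Qed.

Let tE : t = x 1 * (x 2 * (x 1 * x 2)).
Proof. by rewrite /t expg2 !mulgA. Qed.

Let conj_inv (y z : Gamma) : y * y = 1 -> (y * z) ^+ 2 = 1 -> y * z = z^-1 * y.
Proof.
move=> y2; rewrite expg2 => yz2.
by rewrite -(mulg1_eq yz2) invgM (mulg1_eq y2).
Qed.

Let x0t : x 0 * t = t^-1 * x 0.
Proof. by apply: conj_inv; rewrite ?xG_sqr // tE x_01212. Qed.

Let x1t : x 1 * t = t^-1 * x 1.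
Proof.
apply: conj_inv; rewrite ?xG_sqr // tE xK expg2.
by rewrite -!mulgA !xK xG_sqr.
Qed.

Let x2t : x 2 * t = t^-1 * x 2.
Proof.
have -> : t^-1 = (x 2 * x 1) ^+ 2 by rewrite involM_expgV ?xG_sqr.
by rewrite expgM_swap.
Qed.

(** The last relator says that [x 1] commutes with [x2 x3 x2]. Conjugating by [x 2], [x 3] commutes
    with [x2 x1 x2], hence with [t], the product of [x 1] and this element. *)
Let x3t : commute (x 3) t.
Proof.
have c : commute (x 3) (x 2 * (x 1 * x 2)).
  have := conj_inv (@xG_sqr _ _ _ _) (@x_1232 p1 (2 * q) p3).
  rewrite !invgM !xGV => e; rewrite /commute.
  apply: (@mulgI _ (x 2)); apply: (@mulIg _ (x 2)).
  by rewrite -!mulgA !xK xG_sqr mulg1 e !mulgA.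
rewrite tE; apply: commuteM => //.
exact/commute_sym/x_comm.
Qed.

Let inv_swap (y z : Gamma) : y * z = z^-1 * y -> y * z^-1 = z * y.
Proof. by move=> e; apply: (@mulIg _ z); rewrite mulgVK -mulgA e mulVKg. Qed.

Let commute_st : commute s t.
Proof. by rewrite /s /commute -mulgA x1t mulgA (inv_swap x0t) mulgA. Qed.

Let expg_swap (y z : Gamma) n : y * z = z^-1 * y -> y * z ^+ n = z ^- n * y.
Proof.
move=> e; elim: n => [|n IHn]; first by rewrite expg0 invg1 mulg1 mul1g.
by rewrite {1}expgSr mulgA IHn -mulgA e mulgA -invgM -expgS.
Qed.

Let x0s : x 0 * s = s^-1 * x 0.
Proof. by rewrite /s xK invgM !xGV -mulgA xG_sqr mulg1. Qed.

Let x2s : x 2 * s = s * t * x 2.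
Proof.
rewrite /s tE -!mulgA xK xG_sqr mulg1 !mulgA; congr (_ * _).
by apply/esym; exact: x_comm.
Qed.

Let x3s : commute (x 3) s.
Proof. by apply: commuteM; apply/commute_sym/x_comm. Qed.

(** [x 3] is [x 2 * r^-1], and [p3.-1] stands for the exponent -1. *)
Let x23 (c : nat) : x 3 * r ^+ c = x 2 * r ^+ (c + p3.-1).
Proof.
apply: (@mulgI _ (x 2)); rewrite xK; apply: (@mulgI _ r).
rewrite -expgS -addnS prednK // expgnDr r_p3 mulg1.
by rewrite {1}/r -mulgA !xK.
Qed.

(* Normal form of the elements of [Gamma]: the normal abelian subgroup
   generated by [s] and [t], times [x 0], times the dihedral group generated by
   [x 2] and [x 3]. *)
Let nf (a b : nat) (e : bool) (c : nat) (f : bool) : Gamma :=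
  s ^+ a * t ^+ b * x 0 ^+ e * (x 2 ^+ f * r ^+ c).

Let xb j (b : bool) : x j * x j ^+ b = x j ^+ ~~ b.
Proof. by case: b; rewrite ?xG_sqr ?mulg1. Qed.

(** Left multiplication by a generator preserves the shape [nf]. Exponents grow freely here and are
    reduced only in [Gamma_normal_form]; the factors [p1.-1] and [q.-1] encode inversion. *)
Let mulnf0 a b e c f : x 0 * nf a b e c f =
  nf (a * p1.-1) (b * q.-1) (~~ e) c f.
Proof.
rewrite /nf !mulgA; congr (_ * _ * _).
rewrite (expg_swap _ x0s) -(mulgA _ (x 0)) (expg_swap _ x0t).
by rewrite !(expg_inv _ _ s_p1) // !(expg_inv _ _ t_q) // !mulgA -mulgA xb.
Qed.

Let mulnfs a b e c f : s * nf a b e c f = nf a.+1 b e c f.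
Proof. by rewrite /nf !mulgA -expgS. Qed.

Let mulnf1 a b e c f : x 1 * nf a b e c f =
  nf (a.+1 * p1.-1) (b * q.-1) (~~ e) c f.
Proof. by rewrite -mulnf0 -mulnfs /s -mulgA xK. Qed.

Let mulnf2 a b e c f : x 2 * nf a b e c f =
  nf a (a + b * q.-1) e c (~~ f).
Proof.
have x2sX : x 2 * s ^+ a = s ^+ a * t ^+ a * x 2.
  rewrite -expgMn //; elim: a => [|n IHn]; first by rewrite mulg1 mul1g.
  by rewrite [s ^+ _]expgSr mulgA IHn -mulgA x2s mulgA -expgSr.
rewrite /nf expgnDr !mulgA x2sX -!mulgA; congr (_ * (_ * _)).
rewrite (mulgA (x 2)) (expg_swap _ x2t) (expg_inv _ _ t_q) // -!mulgA.
have x20 : commute (x 2) (x 0 ^+ e) by apply/commuteX/commute_sym/x_comm.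
by rewrite (mulgA (x 2)) x20 -!mulgA (mulgA (x 2)) xb.
Qed.

Let mulnf3 a b e c f : x 3 * nf a b e c f =
  nf a b e (if f then c.+1 else c + p3.-1) (~~ f).
Proof.
have x3n : commute (x 3) (s ^+ a * t ^+ b * x 0 ^+ e).
  apply: commuteM; first by apply: commuteM; apply: commuteX.
  by apply: commuteX; apply/commute_sym/x_comm.
rewrite /nf mulgA x3n -mulgA; congr (_ * _).
by case: f; rewrite /= ?expg0 ?expg1 !mul1g; [rewrite expgS -mulgA | rewrite x23].
Qed.

Lemma Gamma_normal_form g : exists a b e c f,
  [/\ (a < p1)%N, (b < q)%N, (c < p3)%N & g = nf a b e c f].
Proof.
suff [a [b [e [c [f ->]]]]] : exists a b e c f, g = nf a b e c f.
  exists (a %% p1)%N, (b %% q)%N, e, (c %% p3)%N, f.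
  by split; rewrite ?ltn_mod // /nf !expg_mod.
have : gsub predT g by exact: gsubT.
move: g; apply: gsub_indl => [|j g j4 _ _ [a [b [e [c [f ->]]]]]].
  by exists 0%N, 0%N, false, 0%N, false; rewrite /nf !mulg1.
move: j j4 => [|[|[|[|j]]]] // _; rewrite ?mulnf0 ?mulnf1 ?mulnf2 ?mulnf3;
  by do 5 eexists.
Qed.

(** The exponents are peeled off in order: D(p3) kills [s], [t] and [x 0], so it reads [c] and [f];
    after cancellation D(p1), which kills [t], reads [a] and [e]; D(q) reads what is left. *)
Lemma nf_inj a b e c f a' b' e' c' f' :
  (a < p1)%N -> (b < q)%N -> (c < p3)%N ->
  (a' < p1)%N -> (b' < q)%N -> (c' < p3)%N ->
  nf a b e c f = nf a' b' e' c' f' -> (a, b, e, c, f) = (a', b', e', c', f').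
Proof.
move=> lta ltb ltc lta' ltb' ltc' E.
have [ec ef] : c = c' /\ f = f'.
  have [V [v vn]] := cyclic_zmodType p3_gt0.
  have [phi phiE] := dihedral_image23 p1 q vn (dvdnn p3).
  have phinf k l b1 m b2 : phi (nf k l b1 m b2) =
      reflection 0%R ^+ b2 * rotation (v *+ m)%R.
    rewrite !gmulfM !gmulfXn !gmulfM !phiE //= !mul1g !expg1n !mul1g.
    by rewrite expg2 reflection_sqr expg1n !mul1g mul_reflection subr0 rotationX.
  have := congr1 phi E; rewrite !phinf.
  case: f E; case: f' => E //= [] /eqP; rewrite ?sub0r ?add0r ?eqr_opp;
    by move=> /eqP/(mulrn_inj_order vn) ->.
have {}E : s ^+ a * t ^+ b * x 0 ^+ e = s ^+ a' * t ^+ b' * x 0 ^+ e'.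
  by move: E; rewrite ec ef => /mulIg.
have [ea ee] : a = a' /\ e = e'.
  have [V [v vn]] := cyclic_zmodType p1_gt0.
  have [phi phiE] := dihedral_image01 q p3 vn (dvdnn p1).
  have phinf k l (b1 : bool) : phi (s ^+ k * t ^+ l * x 0 ^+ b1) =
      rotation (- (v *+ k))%R * reflection 0%R ^+ b1.
    rewrite !gmulfM !gmulfXn !gmulfM !phiE //= !mulg1.
    by rewrite expg2 reflection_sqr expg1n mulg1 mul_reflection sub0r rotationX
      mulNrn.
  have := congr1 phi E; rewrite !phinf.
  case: e E; case: e' => E //= [] /eqP; rewrite ?addr0 ?eqr_opp;
    by move=> /eqP/(mulrn_inj_order vn) ->.
have {}E : t ^+ b = t ^+ b' by move: E; rewrite ea ee => /mulIg/mulgI.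
have [V [v vn]] := cyclic_zmodType q_gt0.
have [phi phiE] := dihedral_image012 p3_even vn q_dvd (dvdnn q).
have phit k : phi (t ^+ k) = rotation (v *+ 2 *+ k)%R.
  by rewrite !gmulfXn gmulfM !phiE //= mul_reflection subr0 !rotationX.
(* [t] maps to the rotation by twice [v], still of order [q] because [q] is odd. *)
have v2 m : (v *+ 2 *+ m == 0)%R = (q %| m)%N.
  by rewrite -mulrnA vn Gauss_dvdr // coprimen2.
have := congr1 phi E; rewrite !phit => -[] /(mulrn_inj_order v2) -> //.
by rewrite ec ef ea ee.
Qed.

Lemma card_Gamma : [set: Gamma] #= `I_(2 * p1 * (2 * q) * p3)%N.
Proof.
pose N : finType := ('I_p1 * 'I_q * bool * 'I_p3 * bool)%type.
pose h (n : N) := nf n.1.1.1.1 n.1.1.1.2 n.1.1.2 n.1.2 n.2.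
have h_inj : injective h.
  move=> [[[[a b] e] c] f] [[[[a' b'] e'] c'] f'] /nf_inj.
  by move=> /(_ (ltn_ord _) (ltn_ord _) (ltn_ord _) (ltn_ord _) (ltn_ord _)
    (ltn_ord _)) [/val_inj-> /val_inj-> -> /val_inj-> ->].
have -> : (2 * p1 * (2 * q) * p3 = #|N|)%N.
  by rewrite !card_prod !card_ord card_bool; lia.
pose h' (i : 'I_#|N|) := h (enum_val i).
have -> : [set: Gamma] = h' @` [set: 'I_#|N|].
  apply/seteqP; split=> // g _.
  have [a [b [e [c [f [la lb lc ->]]]]]] := Gamma_normal_form g.
  pose n : N := (Ordinal la, Ordinal lb, e, Ordinal lc, f).
  by exists (enum_rank n) => //; rewrite /h' enum_rankK.
apply: card_eq_trans (inj_card_eq _) _; first by move=> i j _ _ /h_inj/enum_val_inj.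
by rewrite card_eq_sym; exact: card_II.
Qed.

End GammaOrder.

(** * Faces and flags *)

Section Faces.
Variables p1 q p3 : nat.
Local Notation Gamma := (Gamma p1 (2 * q) p3).
Local Notation x n := (xG p1 (2 * q) p3 (inord n%N)).
Local Notation gsub := (@gsub p1 (2 * q) p3).
Local Notation Gr := (@Gr p1 q p3).
Local Notation face := (face p1 (2 * q) p3).
Local Notation Gamma_ := (@Gamma_ p1 (2 * q) p3).
Implicit Types (F H K : face) (a b c g h : Gamma) (A B : set face).

Lemma Gamma_Gr (j : 'I_4) : Gamma_ j = Gr j.+1.
Proof.
apply/seteqP; split; apply: gen_subgroupS => _ [k kj <-]; exists k => //.
Qed.

Definition coset_of (j : 'I_4) a : right_cosets (Gamma_ j) :=
  SigSub (mem_set (ex_intro2 _ _ a I erefl)).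

(* The level of a face is its rank plus one. *)
Definition level F : nat :=
  match F with
  | least_face => 0
  | greatest_face => 5
  | coset_face j _ => j.+1
  end.

Definition face_at (l : nat) a : face :=
  match l with
  | 0 => least_face p1 (2 * q) p3
  | k.+1 => if (k < 4)%N then coset_face (coset_of (inord k) a)
            else greatest_face p1 (2 * q) p3
  end.

(** For a proper face this says that the coset contains [a]; improper faces are incident to every
    element. *)
Definition incident a F := F = face_at (level F) a.

Lemma face_rankE F : face_rank p1 (2 * q) p3 F = ((level F)%:Z - 1)%R.
Proof. by case: F => //= j _; lia. Qed.

Lemma level_face l a : (l <= 5)%N -> level (face_at l a) = l.
Proof.
case: l => //= l; rewrite ltnS; case: ltnP => /= [l4|l4] l5.
  by rewrite inordK.
by congr S; lia.
Qed.

Lemma level_le5 F : (level F <= 5)%N.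
Proof. by case: F => //= j _; have := ltn_ord j; lia. Qed.

Lemma right_cosetE (G : groupType) (S : set G) (y z : G) :
  right_coset S y z <-> S (z / y).
Proof.
split=> [[h Sh <-]|Sz]; first by rewrite mulgK.
by exists (z / y); rewrite ?mulgVK.
Qed.

Lemma right_coset_eq (G : groupType) (S : set G) (y z : G) : is_subgroup S ->
  S (z / y) -> right_coset S y = right_coset S z.
Proof.
move=> sS Szy; apply/seteqP; split=> w /right_cosetE Sw; apply/right_cosetE.
  have -> : w / z = (w / y) / (z / y) by rewrite invgF mulgA mulgVK.
  exact: sS.2.
have -> : w / y = (w / z) * (z / y) by rewrite mulgA mulgVK.
exact: is_subgroupM.
Qed.

Lemma face_surj F : exists a, incident a F.
Proof.
rewrite /incident; case: F => [||j C]; [by exists 1 | by exists 1 |].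
have [a _ aC] := set_valP C; exists a.
rewrite /= ltn_ord inord_val; congr coset_face; apply/val_inj.
by rewrite /= aC.
Qed.

(** Forgets the dependent index, so that an equality of faces yields an equality of cosets as
    sets. *)
Definition face_set F : set Gamma :=
  match F with coset_face j C => val C | _ => set0 end.

Lemma face_atM l h a : face_at l (h * a) = face_at l a <-> Gr l h.
Proof.
case: l => [|l] /=; first by split=> // _; exact: Gr0.
case: ltnP => l4; last by split=> // _; apply: Gr_ge5.
have GE : Gamma_ (inord l) = Gr l.+1 by rewrite Gamma_Gr inordK.
split=> [/(congr1 face_set)/= e|Hh].
  have : right_coset (Gamma_ (inord l)) a (h * a).
    by rewrite -e; apply/right_cosetE; rewrite mulgV GE; exact: gsub1.
  by move/right_cosetE; rewrite mulgK GE.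
congr coset_face; apply/val_inj => /=; apply/esym/right_coset_eq.
  exact: gen_subgroupP.
by rewrite mulgK GE.
Qed.

Lemma face_atP l a b : face_at l a = face_at l b <-> Gr l (a / b).
Proof. by have := face_atM l (a / b) b; rewrite mulgVK. Qed.

Lemma incident_face l a : (l <= 5)%N -> incident a (face_at l a).
Proof. by move=> l5; rewrite /incident level_face. Qed.

Lemma incidentM h a F : incident a F -> Gr (level F) h -> incident (h * a) F.
Proof.
move=> aF Hh; rewrite /incident aF level_face ?level_le5 //.
exact/esym/face_atM.
Qed.

Lemma incident_Gr a b F : incident a F -> incident b F -> Gr (level F) (b / a).
Proof. by rewrite /incident => aF bF; apply/face_atP; rewrite -aF -bF. Qed.

Lemma incident_eq a F H : incident a F -> incident a H -> level F = level H ->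
  F = H.
Proof. by move=> aF aH lFH; rewrite aF aH lFH. Qed.

Lemma face_leP F H : (F <= H)%O <->
  (level F <= level H)%N /\ exists a, incident a F /\ incident a H.
Proof.
split.
  move: F H => [||j C] [||k D] // le; split=> //; try by exists 1.
  - have [a aH] := face_surj (coset_face D); by exists a.
  - have := ltn_ord j; rewrite /=; lia.
  - have [a aF] := face_surj (coset_face C); by exists a.
  - by move: le => /andP[].
  move: le => /andP[jk /asboolP[a [Ca Da]]]; exists a; rewrite /incident.
  have coset_at i (E : right_cosets (Gamma_ i)) : val E a ->
      coset_face E = face_at i.+1 a.
    rewrite /= ltn_ord inord_val => Ea; congr coset_face; apply/val_inj => /=.
    have [b _ bE] := set_valP E; rewrite -bE in Ea *.
    by apply: right_coset_eq; [exact: gen_subgroupP | apply/right_cosetE].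
  by split; exact: coset_at.
move=> [lFH [a [-> ->]]]; move: (level_le5 F) (level_le5 H) lFH.
move: (level F) (level H) => l m l5 m5 lm.
case: l l5 lm => // l l5; case: m m5 => // m m5 /= lm.
case: ltnP => l4; case: ltnP => m4 //; last by lia.
rewrite /Order.le /= !inordK // -ltnS lm; apply/asboolP; exists a.
by split; apply/right_cosetE; rewrite mulgV; apply: (gen_subgroupP _).1.
Qed.

Lemma face_ltP F H : (F < H)%O <->
  (level F < level H)%N /\ exists a, incident a F /\ incident a H.
Proof.
split.
  move=> FH; have [lFH [a [aF aH]]] := (face_leP F H).1 (ltW FH).
  split; last by exists a.
  rewrite ltn_neqAle lFH andbT; apply/eqP => e.
  by rewrite (incident_eq aF aH e) ltxx in FH.
move=> [lFH [a [aF aH]]]; rewrite lt_neqAle; apply/andP; split.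
  by apply/eqP => e; rewrite e ltnn in lFH.
by apply/face_leP; split; [exact: ltnW | exists a].
Qed.

Lemma incident_comparable a F H : incident a F -> incident a H -> (F >=< H)%O.
Proof.
move=> aF aH; rewrite /Order.comparable; apply/orP.
have [le|le] := leqP (level F) (level H); [left | right]; apply/face_leP.
  by split=> //; exists a.
by split; [exact: ltnW | exists a].
Qed.

Lemma Gr_split l g : Gr l g -> exists u v,
  [/\ gsub [pred k | k.+1 < l]%N u, gsub [pred k | l < k.+1]%N v & g = u * v].
Proof.
case: l => [|l] Hg.
  exists 1, g; split; rewrite ?mul1g //; exact: gsub1.
have nl : ~~ [pred k | k.+1 != l.+1] l by rewrite /= eqxx.
have [u [v [Hu Hv ->]]] := gsub_split nl Hg; exists u, v; split=> //.
  by apply: gsubS Hu => j j4 /=; lia.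
by apply: gsubS Hv => j j4 /=; lia.
Qed.

(* Two partial flags meeting in a face [T] have a common point: if [b / a] lies
   in the stabilizer of [T], split it as [u * v] with [u] fixing all faces above
   [T] and [v] fixing all faces below, and take [v * a]. *)
Lemma chain_incident A : is_chain A -> exists a, forall F, A F -> incident a F.
Proof.
(* Induction on the level [n]: [T] is the highest face of the chain up to level [n], or the least
   face when there is none. *)
move=> chA; suff /(_ 5) [a [T [_ _ _ aA]]] : forall n, exists a T,
    [/\ T = least_face _ _ _ \/ A T, (level T <= n)%N, incident a T &
        forall F, A F -> (level F <= n)%N ->
          (level F <= level T)%N /\ incident a F].
  by exists a => F AF; have [] := aA F AF (level_le5 F).
elim=> [|n [a [T [AT Tn aT aA]]]].
  exists 1, (least_face p1 (2 * q) p3); split; [by left | by [] | by [] |].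
  by move=> F _ F0; split=> //; case: F F0.
have [[D [AD Dn]]|noD] := pselect (exists D, A D /\ level D = n.+1); last first.
  exists a, T; split=> // [|F AF Fn]; first exact: leqW.
  apply: aA => //; rewrite -ltnS ltn_neqAle Fn andbT.
  by apply/eqP => e; apply: noD; exists F.
have [b [bT bD]] : exists b, incident b T /\ incident b D.
  case: AT => [->|AT]; first by have [b bD] := face_surj D; exists b.
  have := chA _ _ AT AD; rewrite /Order.comparable => /orP[] /face_leP[_ [b []]];
    by exists b.
have [u [v [Hu Hv baE]]] := Gr_split (incident_Gr aT bT).
have bE : u^-1 * b = v * a.
  by rewrite -[b](mulgVK a) baE !mulgA mulVg mul1g.
exists (v * a), D; split; [by right | by rewrite Dn | |].
  rewrite -bE; apply: incidentM bD _; apply: gsubV.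
  by apply: gsubS Hu => j j4 /=; lia.
move=> F AF Fn; rewrite Dn; split=> //.
have [e|ne] := eqVneq (level F) n.+1.
  have -> : F = D.
    have := chA _ _ AF AD; rewrite /Order.comparable => /orP[];
      move=> /face_leP[_ [c [cF cD]]].
      by apply: incident_eq cF cD _; rewrite e.
    by apply: incident_eq cD cF _; rewrite e.
  rewrite -bE; apply: incidentM bD _; apply: gsubV.
  by apply: gsubS Hu => j j4 /=; lia.
have [|lT aF] := aA F AF; first by lia.
apply: incidentM aF _; apply: gsubS Hv => j j4 /=; lia.
Qed.

Lemma incident3 F H K : (F < H)%O -> (H < K)%O ->
  exists a, [/\ incident a F, incident a H & incident a K].
Proof.
move=> FH HK; pose A := [set E | [\/ E = F, E = H | E = K]].
have [|a aA] := @chain_incident A; last by exists a; split; apply: aA; constructor.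
have FK := lt_trans FH HK.
move=> E1 E2 [] -> [] ->; rewrite ?comparablexx //;
  by rewrite /Order.comparable ?(ltW FH)
    ?(ltW HK) ?(ltW FK) ?orbT.
Qed.

Definition flag a : set face := [set F | incident a F].

Lemma flag_chain a : is_chain (flag a).
Proof. by move=> F H; exact: incident_comparable. Qed.

(** Maximality holds because [flag a] has a face at every level and comparable faces of equal level
    coincide. *)
Lemma flag_is_flag a : is_flag (flag a).
Proof.
split; first exact: flag_chain.
move=> B chB sB; apply/seteqP; split=> // F BF.
have /sB BFa : flag a (face_at (level F) a).
  by apply: incident_face; exact: level_le5.
have lF := level_face a (level_le5 F); rewrite /flag /= /incident.
have := chB _ _ BF BFa; rewrite /Order.comparable => /orP[] /face_leP[_ [c [c1 c2]]].
  exact: incident_eq c1 c2 _.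
exact: incident_eq c2 c1 _.
Qed.

Lemma is_flagP A : is_flag A -> exists a, A = flag a.
Proof.
move=> [chA maxA]; have [a aA] := chain_incident chA.
by exists a; apply: maxA; [exact: flag_chain | exact: aA].
Qed.

Lemma flag_card a : flag a #= `I_6.
Proof.
have -> : flag a = (face_at ^~ a) @` `I_6.
  apply/seteqP; split=> [F aF|_ [l /= l6 <-]]; last exact: incident_face.
  by exists (level F); [exact: level_le5 | rewrite -aF].
apply: inj_card_eq => l m; rewrite !inE /= => l6 m6 /(congr1 level).
by rewrite !level_face.
Qed.

End Faces.

(** * The polytope *)

Arguments face_at : simpl never.

Section Polytope.
Variables p1 q p3 : nat.
Local Notation Gamma := (Gamma p1 (2 * q) p3).
Local Notation x n := (xG p1 (2 * q) p3 (inord n%N)).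
Local Notation gsub := (@gsub p1 (2 * q) p3).
Local Notation Gr := (@Gr p1 q p3).
Local Notation face := (face p1 (2 * q) p3).
Local Notation rank := (face_rank p1 (2 * q) p3).
Implicit Types (F H K : face) (a b c g h : Gamma) (A B : set face).

Lemma face_at_le l m a : (l <= m <= 5)%N -> (face_at l a <= face_at m a :> face)%O.
Proof.
move=> lm; apply/face_leP; rewrite !level_face; [|lia|lia].
split; first by lia.
by exists a; split; apply: incident_face; lia.
Qed.

Lemma face_at_lt l m a : (l < m <= 5)%N -> (face_at l a < face_at m a :> face)%O.
Proof.
move=> lm; apply/face_ltP; rewrite !level_face; [|lia|lia].
split; first by lia.
by exists a; split; apply: incident_face; lia.
Qed.

Lemma face_is_ranked : is_ranked 4 rank.
Proof.
split=> // F K; rewrite !face_rankE; first by move=> /face_ltP[]; lia.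
move=> FK noH; have [lFK [a [aF aK]]] := (face_ltP F K).1 FK.
have K5 := level_le5 K; have [e|ne] := eqVneq (level K) (level F).+1.
  by rewrite e; lia.
case: (noH (face_at (level F).+1 a)); apply/andP; split.
  by rewrite {1}aF; apply: face_at_lt; lia.
by rewrite {1}aK; apply: face_at_lt; lia.
Qed.

Hypotheses (p1_gt2 : (2 < p1)%N) (p1_odd : odd p1) (q_dvd : (q %| p1)%N).
Hypotheses (p3_gt0 : (0 < p3)%N) (p3_even : ~~ odd p3).

Let x_notin j : (j < 4)%N -> ~ Gr j.+1 (x j) :=
  @x_notin_Gr _ _ _ p1_gt2 p1_odd q_dvd p3_gt0 p3_even j.

Lemma section_gsub F K a b : (F < K)%O -> ((level F).+1 < level K)%N ->
  incident a F -> incident a K -> incident b F -> incident b K ->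
  gsub [pred k | k.+1 != level F & k.+1 != level K] (b / a).
Proof.
move=> FK lFK aF aK bF bK; apply: Gr_cap => //.
- by rewrite lFK level_le5.
- exact: incident_Gr.
- exact: incident_Gr.
Qed.

(** [b / a] is a word in generators that fix [F] and [K]. A letter [x j] changes only the face at
    level [j.+1]; at least two levels lie strictly inside the section, so some other level [r] has a
    face common to the points before and after the letter, and the path passes through it. *)
Lemma face_connected_sections : connected_sections rank.
Proof.
move=> F K _; rewrite !face_rankE => lFK H H' /andP[FH HK] /andP[FH' HK'].
have [a [aF aH aK]] := incident3 FH HK.
have [b [bF bH' bK]] := incident3 FH' HK'.
have FK := lt_trans FH HK.
pose P h := forall E, incident (h * a) F -> incident (h * a) K ->
  incident (h * a) E -> (F < E < K)%O ->
  exists s : seq face, [/\ path >=<%O H s, last H s = E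
                         & all (fun E => F < E < K)%O s].
suff PT : gsub [pred k | k.+1 != level F & k.+1 != level K] `<=` P.
  apply: (PT (b / a)); rewrite ?mulgVK ?FH' //.
  by apply: section_gsub => //; lia.
have rank1 E : incident a E -> (F < E < K)%O -> exists s : seq face,
    [/\ path >=<%O H s, last H s = E & all (fun E => F < E < K)%O s].
  move=> aE FEK; exists [:: E]; split; rewrite /= ?FEK // andbT.
  exact: incident_comparable aH aE.
apply: gsub_indl => [E _ _|j h j4 /andP[/= jF jK] hB Ph E _ _ hE FEK].
  by rewrite mul1g => aE; exact: rank1.
have K5 := level_le5 K.
have hF : incident (h * a) F.
  by apply: incidentM aF _; apply: gsubS hB => k k4 /=; lia.
have hK : incident (h * a) K.
  by apply: incidentM aK _; apply: gsubS hB => k k4 /=; lia.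
have [r [Fr rK jr]] : exists r, [/\ (level F < r)%N, (r < level K)%N & j.+1 != r].
  have [e|ne] := eqVneq j.+1 (level F).+1.
    by exists (level F).+2; split; lia.
  by exists (level F).+1; split; lia.
have FrK : (F < face_at r (h * a) < K)%O.
  by rewrite {1}hF {1}hK !face_at_lt //; lia.
have r5 : (r <= 5)%N by lia.
have [s [ps ls sB]] := Ph (face_at r (h * a)) hF hK (incident_face _ r5) FrK.
exists (rcons s E); rewrite rcons_path last_rcons all_rcons ps ls FEK sB.
split=> //=; apply: incident_comparable hE.
rewrite /incident level_face // -mulgA; apply/esym/face_atM.
exact: x_in_Gr.
Qed.

Lemma face_diamond : diamond_condition rank.
Proof.
move=> F K FK; rewrite !face_rankE => lFK.
have [_ [a [aF aK]]] := (face_ltP F K).1 FK.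
have K5 := level_le5 K; set l := level F.
have lK : level K = l.+2 by rewrite /l; lia.
have l4 : (l < 4)%N by lia.
pose f (i : nat) : face := face_at l.+1 (x l ^+ i * a).
have -> : [set H | F < H < K]%O = f @` `I_2.
  apply/seteqP; split=> [H /= /andP[FH HK]|_ [i i2 <-]] /=.
    have lH : level H = l.+1.
      by have [] := (face_ltP F H).1 FH; have [] := (face_ltP H K).1 HK; lia.
    have [b [bF bH bK]] := incident3 FH HK.
    have Kb := incident_Gr aK bK; rewrite lK in Kb.
    have [Hb|Hb] := Gr_cap_gen1 p1_gt2 p1_odd q_dvd p3_gt0 p3_even l4
      (incident_Gr aF bF) Kb.
      exists 0%N => //; rewrite /f expg0 mul1g bH lH.
      exact/esym/face_atP.
    exists 1%N => //; rewrite /f bH lH; apply/esym/face_atP.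
    by rewrite expg1 invgM xGV mulgA.
  have xaF : incident (x l ^+ i * a) F.
    by apply: incidentM aF _; apply: gsubX; apply: x_in_Gr => //; rewrite /l; lia.
  have xaK : incident (x l ^+ i * a) K.
    by apply: incidentM aK _; apply: gsubX; apply: x_in_Gr => //; rewrite lK; lia.
  by rewrite /f {1}xaF {1}xaK !face_at_lt //; lia.
apply: inj_card_eq => i j; rewrite !inE /f /= => i2 j2.
have ne : face_at l.+1 (x l * a) <> face_at l.+1 a.
  by move=> /face_atM; exact: x_notin.
case: i i2 j j2 => [|[|i]] // _ [|[|j]] // _; rewrite expg0 expg1 mul1g => e.
  by case: ne.
by case: ne.
Qed.

Lemma face_is_polytope : is_polytope 4 rank.
Proof.
split; [exact: face_is_ranked | | exact: face_connected_sections
  | exact: face_diamond].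
by move=> A /is_flagP[a ->]; exact: flag_card.
Qed.

Lemma face_section_is_gon m F K :
  (F < K)%O -> level F = m -> level K = m.+3 ->
  section_is_gon rank (period p1 q p3 m) F K.
Proof.
move=> FK <-{m} lK; split; first by rewrite !face_rankE; lia.
have [_ [a [aF aK]]] := (face_ltP F K).1 FK.
have K5 := level_le5 K; set l := level F; have l3 : (l < 3)%N by rewrite /l; lia.
rewrite -/l in lK.
set s := x l.+1 * x l; set p := period p1 q p3 l.
have sp : s ^+ p = 1 by exact: period_expg.
have p_gt0 : (0 < p)%N by apply: ltnW; exact: period_gt1.
have sG r m : (r == l.+1) || (r == l.+2) -> Gr r (s ^+ m) -> (p %| m)%N.
  exact: Gr_rotation.
have x_in j r : (j < 4)%N -> j.+1 != r -> Gr r (x j) by exact: x_in_Gr.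
have s_in r m : r != l.+1 -> r != l.+2 -> Gr r (s ^+ m).
  by move=> r1 r2; apply: gsubX; apply: gsubM; apply: x_in; lia.
have s_inj r : (r == l.+1) || (r == l.+2) ->
    forall i j : 'I_p, face_at r (s ^+ i * a) = face_at r (s ^+ j * a) -> i = j.
  move=> hr; suff le (i j : 'I_p) : (i <= j)%N ->
      face_at r (s ^+ j * a) = face_at r (s ^+ i * a) -> i = j.
    move=> i j; case/orP: (leq_total i j) => ij e.
      exact: le ij (esym e).
    exact: esym (le _ _ ij e).
  move=> ij /face_atP; rewrite invgM mulgA mulgK -expgnFr //.
  move/(sG _ _ hr) => pd; apply/val_inj/eqP; rewrite eqn_leq ij /= -subn_eq0.
  apply: contraLR pd => ne; rewrite gtnNdvd ?lt0n //.
  by have := ltn_ord j; lia.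
have modp r m : face_at r (s ^+ m * a) = face_at r (s ^+ (m %% p) * a).
  by rewrite expg_mod.
have saF m : incident (s ^+ m * a) F.
  by apply: incidentM aF _; apply: s_in; rewrite -/l; lia.
have saK m : incident (s ^+ m * a) K.
  by apply: incidentM aK _; apply: s_in; rewrite lK; lia.
(* A point of the section is, up to the stabilizer of both its vertex and its
   edge, a power of the rotation or [x l] times such a power. *)
have points b : incident b F -> incident b K -> exists i : nat,
    face_at l.+2 b = face_at l.+2 (s ^+ i * a) /\
    (face_at l.+1 b = face_at l.+1 (s ^+ i * a) \/
     face_at l.+1 b = face_at l.+1 (s ^+ i.+1 * a)).
  move=> bF bK; have Kb := incident_Gr aK bK; rewrite lK in Kb.
  have [h [i [h1 h2 bE]]] := Gr_cap_gen2 p1_gt2 p1_odd q_dvd p3_gt0 p3_even l3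
    (incident_Gr aF bF) Kb.
  exists i; case: bE => bE.
    have {}bE : b = h * (s ^+ i * a) by rewrite mulgA -bE mulgVK.
    by split; [|left]; rewrite bE; apply/face_atM.
  have {}bE : b = h * (x l * (s ^+ i * a)) by rewrite !mulgA -bE mulgVK.
  split; rewrite bE.
    by rewrite mulgA; apply/face_atM; apply: gsubM h2 _; apply: x_in; lia.
  (* Since [x l = x l.+1 * s] and [x l.+1] fixes the vertex, the vertex is read from the next power
     of [s]. *)
  right; have -> : h * (x l * (s ^+ i * a)) = h * x l.+1 * (s ^+ i.+1 * a).
    by rewrite expgS /s -!mulgA xK.
  by apply/face_atM; apply: gsubM h1 _; apply: x_in; lia.
exists (fun i : 'I_p => face_at l.+1 (s ^+ i * a)),
       (fun i : 'I_p => face_at l.+2 (s ^+ i * a)); split.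
- by move=> i j; apply: s_inj; rewrite eqxx.
- by move=> i j; apply: s_inj; rewrite eqxx orbT.
- apply/seteqP; split=> [_ [i _ <-]|H [/andP[FH HK]]].
    rewrite /mkset !face_rankE level_face; last by lia.
    split; last by rewrite /l; lia.
    by rewrite {1}(saF i) {1}(saK i) !face_at_lt //; lia.
  rewrite !face_rankE => lH; have {}lH : level H = l.+1 by rewrite /l; lia.
  have [b [bF bH bK]] := incident3 FH HK.
  have [i [_ []]] := points b bF bK; rewrite modp => e.
    by exists (Ordinal (ltn_pmod i p_gt0)) => //; rewrite bH lH e.
  by exists (Ordinal (ltn_pmod i.+1 p_gt0)) => //; rewrite bH lH e.
- apply/seteqP; split=> [_ [i _ <-]|H [/andP[FH HK]]].
    rewrite /mkset !face_rankE level_face; last by lia.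
    split; last by rewrite /l; lia.
    by rewrite {1}(saF i) {1}(saK i) !face_at_lt //; lia.
  rewrite !face_rankE => lH; have {}lH : level H = l.+2 by rewrite /l; lia.
  have [b [bF bH bK]] := incident3 FH HK.
  have [i [e _]] := points b bF bK; rewrite modp in e.
  by exists (Ordinal (ltn_pmod i p_gt0)) => //; rewrite bH lH e.
have l1 : (l.+1 <= 5)%N by lia.
have l2 : (l.+2 <= 5)%N by lia.
move=> i j; split=> [ve|].
  have [b [bF bv be bK]] : exists b, [/\ incident b F,
      incident b (face_at l.+1 (s ^+ i * a)),
      incident b (face_at l.+2 (s ^+ j * a)) & incident b K].
    pose A := [set E | [\/ E = F, E = face_at l.+1 (s ^+ i * a),
                           E = face_at l.+2 (s ^+ j * a) | E = K]].
    have [|b bA] := @chain_incident _ _ _ A; last first.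
      by exists b; split; apply: bA; constructor.
    have Fv : (F <= face_at l.+1 (s ^+ i * a))%O.
      by rewrite (saF i) face_at_le //; lia.
    have eK : (face_at l.+2 (s ^+ j * a) <= K)%O.
      by rewrite (saK j) face_at_le //; lia.
    have vK := le_trans ve eK.
    have Fe := le_trans Fv ve.
    have leFK := ltW FK.
    by move=> E1 E2 [] -> [] ->; rewrite ?comparablexx //;
      rewrite /Order.comparable ?Fv ?eK ?vK ?Fe ?ve ?leFK ?orbT.
  have [k [ke kv]] := points b bF bK.
  rewrite /incident level_face // in bv; rewrite /incident level_face // in be.
  have kj : j = Ordinal (ltn_pmod k p_gt0).
    by apply: (s_inj l.+2); rewrite ?eqxx ?orbT //= -modp -ke.
  case: kv => kv; [left | right].
    by rewrite kj; apply: (s_inj l.+1); rewrite ?eqxx //= -modp -kv.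
  apply: (s_inj l.+1); rewrite ?eqxx // bv kv kj modp /=.
  by rewrite -[k.+1]addn1 -[(k %% p).+1]addn1 modnDml.
case=> [->|->]; first by apply: face_at_le; lia.
(* Edge [j] contains vertex [j + 1]: both pass through the point [x l * (s ^+ j * a)], because
   [x l.+1] fixes faces at level [l.+1] and [x l] those at level [l.+2]. *)
rewrite /= -modp; have -> : face_at l.+1 (s ^+ j.+1 * a) =
    face_at l.+1 (x l * (s ^+ j * a)).
  have -> : s ^+ j.+1 * a = x l.+1 * (x l * (s ^+ j * a)).
    by rewrite expgS /s -!mulgA.
  by apply/face_atM; apply: x_in; lia.
have -> : face_at l.+2 (s ^+ j * a) = face_at l.+2 (x l * (s ^+ j * a)).
  by apply/esym/face_atM; apply: x_in; lia.
by apply: face_at_le; lia.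
Qed.

Lemma face_has_type : has_type4 rank p1 (2 * q) p3.
Proof.
split=> [F|F K|F]; rewrite !face_rankE => lF.
- apply: (@face_section_is_gon 0) => //; last by lia.
  have [a aF] := face_surj F; apply/face_ltP; split; first by rewrite /=; lia.
  by exists a.
- by move=> lK FK; apply: (@face_section_is_gon 1) => //; lia.
- apply: (@face_section_is_gon 2) => //; last by lia.
  have [a aF] := face_surj F; apply/face_ltP; split; first by rewrite /=; lia.
  by exists a.
Qed.

End Polytope.

(** * Automorphisms *)

Lemma card_right_cosets2 (G : groupType) (S : set G) (r : G) : is_subgroup S ->
  r * r = 1 -> ~ S r -> (forall y, S y \/ S (y * r)) -> right_cosets S #= `I_2.
Proof.
move=> sS r2 nSr Sr; have rV : r^-1 = r := mulg1_eq r2.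
pose f (i : nat) := right_coset S (r ^+ i).
have -> : right_cosets S = f @` `I_2.
  apply/seteqP; split=> [_ [y _ <-]|_ [i _ <-]]; last by exists (r ^+ i).
  case: (Sr y) => Sy; [exists 0%N | exists 1%N] => //; rewrite /f.
    by apply: right_coset_eq => //; rewrite invg1 mulg1.
  by apply: right_coset_eq => //; rewrite expg1 rV.
apply: inj_card_eq => i j; rewrite !inE /f /= => i2 j2.
have ne : right_coset S r <> right_coset S 1.
  move=> e; apply: nSr; rewrite -[r]mulg1 -[in X in _ * X]invg1.
  by apply/right_cosetE; rewrite -e; apply/right_cosetE; rewrite mulgV; exact: sS.1.
by case: i i2 j j2 => [|[|i]] // _ [|[|j]] // _;
  rewrite ?expg0 ?expg1 => e; case: ne.
Qed.

Section Automorphisms.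
Variables p1 q p3 : nat.
Local Notation Gamma := (Gamma p1 (2 * q) p3).
Local Notation x n := (xG p1 (2 * q) p3 (inord n%N)).
Local Notation gsub := (@gsub p1 (2 * q) p3).
Local Notation Gr := (@Gr p1 q p3).
Local Notation face := (face p1 (2 * q) p3).
Local Notation rank := (face_rank p1 (2 * q) p3).
Implicit Types (F H K : face) (a b c g h : Gamma) (A B : set face).

Definition face_pt F : Gamma := projT1 (cid (face_surj F)).

(** Right multiplication of cosets; [face_act_at] shows that the chosen point does not matter. *)
Definition face_act g F : face := face_at (level F) (face_pt F * g).

Lemma face_act_at g l a : (l <= 5)%N ->
  face_act g (face_at l a) = face_at l (a * g).
Proof.
move=> l5; rewrite /face_act level_face //; apply/face_atP.
rewrite invgM mulgA mulgK; apply/face_atP.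
rewrite /face_pt; case: cid => c /= cF.
by rewrite [RHS]cF level_face.
Qed.

Lemma face_actE g a F : incident a F -> face_act g F = face_at (level F) (a * g).
Proof. by move=> aF; rewrite {1}aF face_act_at // level_le5. Qed.

Lemma level_act g F : level (face_act g F) = level F.
Proof. by rewrite /face_act level_face ?level_le5. Qed.

Lemma incident_act g a F : incident a F -> incident (a * g) (face_act g F).
Proof.
by move=> aF; rewrite (face_actE _ aF); apply: incident_face; exact: level_le5.
Qed.

Lemma face_actM g h F : face_act (g * h) F = face_act h (face_act g F).
Proof.
have [a aF] := face_surj F.
by rewrite (face_actE _ aF) (face_actE _ (incident_act g aF)) level_act mulgA.
Qed.

Lemma face_act1 F : face_act 1 F = F.
Proof. by have [a aF] := face_surj F; rewrite (face_actE _ aF) mulg1 -aF. Qed.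

Lemma face_act_homo g F H : (F <= H)%O -> (face_act g F <= face_act g H)%O.
Proof.
move=> /face_leP[lFH [a [aF aH]]]; apply/face_leP; rewrite !level_act; split=> //.
by exists (a * g); split; exact: incident_act.
Qed.

Lemma face_actK g : cancel (face_act g) (face_act g^-1).
Proof. by move=> F; rewrite -face_actM mulgV face_act1. Qed.

Lemma face_act_automorphism g : is_automorphism (face_act g).
Proof.
split.
  exists (face_act g^-1); first exact: face_actK.
  by move=> F; rewrite -face_actM mulVg face_act1.
move=> F H; apply/idP/idP; last exact: face_act_homo.
by move/(face_act_homo g^-1); rewrite !face_actK.
Qed.

Definition face_aut g : aut face := SigSub (mem_set (face_act_automorphism g)).

Lemma face_autM g h : face_aut (g * h) = face_aut g * face_aut h.
Proof. by apply: aut_eq => F; exact: face_actM. Qed.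

Lemma face_aut1 : face_aut 1 = 1.
Proof. by apply: aut_eq => F; exact: face_act1. Qed.

Lemma face_autV g : face_aut g^-1 = (face_aut g)^-1.
Proof. by apply/esym/mulg1_eq; rewrite -face_autM mulgV face_aut1. Qed.

Lemma face_act_flag g a : face_act g @` flag a = flag (a * g).
Proof.
apply/seteqP; split=> [_ [F aF <-]|F aF]; first exact: incident_act.
exists (face_act g^-1 F); last by rewrite -face_actM mulVg face_act1.
by rewrite -[a](mulgK g); exact: incident_act.
Qed.

Lemma face_is_regular : is_regular face.
Proof.
move=> A B /is_flagP[a ->] /is_flagP[b ->].
by exists (face_aut (a^-1 * b)); rewrite face_act_flag mulVKg.
Qed.

Lemma aut_lt (f : aut face) F H : (F < H)%O -> (aut_fun f F < aut_fun f H)%O.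
Proof.
have [[f' fK _] mf] := aut_funP f.
rewrite !lt_neqAle mf => /andP[ne ->]; rewrite andbT.
by apply: contraNneq ne => /(can_inj fK)->.
Qed.

(** Along a flag [f] induces a strictly increasing map of the levels 0 to 5 into themselves, which
    can only be the identity. *)
Lemma aut_level (f : aut face) F : level (aut_fun f F) = level F.
Proof.
have [a aF] := face_surj F.
pose n l := level (aut_fun f (face_at l a)).
have n_lt l : (l < 5)%N -> (n l < n l.+1)%N.
  move=> l5; have /(aut_lt f)/face_ltP[] // :
      (face_at l a < face_at l.+1 a :> face)%O.
  by apply: face_at_lt; lia.
have n5 : (n 5 <= 5)%N by exact: level_le5.
have [n0 n1 n2 n3 n4] := And5 (n_lt 0 isT) (n_lt 1%N isT) (n_lt 2 isT)
  (n_lt 3 isT) (n_lt 4 isT).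
have {aF} -> : level (aut_fun f F) = n (level F) by rewrite /n -aF.
by move: (level_le5 F); case: (level F) => [|[|[|[|[|[|l]]]]]] // _; lia.
Qed.

Hypotheses (p1_gt2 : (2 < p1)%N) (p1_odd : odd p1) (q_dvd : (q %| p1)%N).
Hypotheses (p3_gt0 : (0 < p3)%N) (p3_even : ~~ odd p3).

Let x_notin j : (j < 4)%N -> ~ Gr j.+1 (x j) :=
  @x_notin_Gr _ _ _ p1_gt2 p1_odd q_dvd p3_gt0 p3_even j.

Lemma face_at_inj a b :
  (forall l, (l <= 5)%N -> face_at l a = face_at l b) -> a = b.
Proof.
move=> e; apply: divg1_eq; apply: Gr_trivial => // l l5.
by apply/face_atP/e; lia.
Qed.

Lemma flag_inj : injective (@flag p1 q p3).
Proof.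
move=> a b e; apply: face_at_inj => l l5.
have : flag b (face_at l a) by rewrite -e; exact: incident_face.
by rewrite /flag /= /incident level_face.
Qed.

Lemma face_is_tight : is_tight4 face p1 (2 * q) p3.
Proof.
have cG : [set: Gamma] #= `I_(2 * p1 * (2 * q) * p3)%N by exact: card_Gamma.
apply: card_eq_trans cG.
have -> : [set A | is_flag A] = @flag p1 q p3 @` [set: Gamma].
  apply/seteqP; split=> [A /is_flagP[a ->]|_ [a _ <-]]; first by exists a.
  exact: flag_is_flag.
by apply: inj_card_eq => a b _ _; exact: flag_inj.
Qed.

Lemma face_aut_inj : injective face_aut.
Proof.
move=> g h e; apply: face_at_inj => l l5.
have : aut_fun (face_aut g) (face_at l 1) = aut_fun (face_aut h) (face_at l 1).
  by rewrite e.
by rewrite /aut_fun /= !face_act_at // !mul1g.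
Qed.

Lemma aut_flag (f : aut face) a : exists b,
  forall l, (l <= 5)%N -> aut_fun f (face_at l a) = face_at l b.
Proof.
have [|b bA] := @chain_incident _ _ _ (aut_fun f @` flag a).
  have [_ mf] := aut_funP f.
  move=> _ _ [F aF <-] [H aH <-]; rewrite /Order.comparable !mf.
  exact: incident_comparable aF aH.
exists b => l l5; have : incident b (aut_fun f (face_at l a)).
  by apply: bA; exists (face_at l a) => //; exact: incident_face.
by rewrite {1}/incident aut_level level_face.
Qed.

(* An automorphism is determined by the image of one flag: adjacent flags have
   adjacent images, and the image of the replaced face is forced by the diamond
   condition. *)
Lemma face_aut_surj (f : aut face) : exists g, f = face_aut g.
Proof.
have [b fb] := aut_flag f 1; exists b; apply: aut_eq => F.
have [[f' fK _] _] := aut_funP f.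
suff fE h : forall l, (l <= 5)%N -> aut_fun f (face_at l h) = face_at l (h * b).
  have [a aF] := face_surj F.
  rewrite [in LHS]aF fE ?level_le5 //; apply/esym; exact: face_actE.
have : gsub predT h by exact: gsubT.
move: h; apply: gsub_indl => [l l5|j h j4 _ _ IH l l5].
  by rewrite mul1g; exact: fb.
have sameE k c : k != j.+1 -> face_at k (x j * c) = face_at k c.
  by move=> kj; apply/face_atM; apply: x_in_Gr; rewrite // eq_sym.
have [el|nl] := eqVneq l j.+1; last first.
  by rewrite -mulgA !sameE // IH.
have [c fc] := aut_flag f (x j * h).
have cG k : k != j.+1 -> (k <= 5)%N -> Gr k (c / (h * b)).
  by move=> kj k5; apply/face_atP; rewrite -fc // sameE // IH.
(* At level [j.+1] the image is the face through [h * b] or the one through [x j * h * b]; the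
   former is already the image of the face through [h], so injectivity of [f] excludes it. *)
have [||Hc|Hc] := Gr_cap_gen1 p1_gt2 p1_odd q_dvd p3_gt0 p3_even j4
  (g := c / (h * b)); [by apply: cG; lia | by apply: cG; lia | |].
  case: (x_notin j4); apply/(face_atM j.+1 (x j) h).
  apply: (can_inj fK); rewrite fc; last by lia.
  by rewrite IH; [apply/face_atP | lia].
rewrite fc // el; apply/face_atP.
by rewrite -mulgA invgM xGV mulgA.
Qed.

Lemma reflection_adjacent (j : 'I_4) a :
  adjacent rank j%:Z%R (flag a) (flag (xG p1 (2 * q) p3 j * a)).
Proof.
have xj : xG p1 (2 * q) p3 j = x j by rewrite inord_val.
split=> [/flag_inj e|F].
  have x1 : x j = 1 by rewrite -xj; apply: (@mulIg _ a); rewrite -e mul1g.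
  by case: (@x_notin j) => //; rewrite x1; exact: gsub1.
rewrite xj face_rankE => Fj; rewrite /flag /= /incident.
suff -> : face_at (level F) (x j * a) = face_at (level F) a by [].
apply/face_atM; apply: x_in_Gr => //; apply/eqP => e.
by apply: Fj; rewrite -e; lia.
Qed.

Lemma face_is_orientably_regular : is_orientably_regular 4 rank.
Proof.
split; first exact: face_is_regular.
move=> _ /is_flagP[a ->].
(* The action is on the right, so this conjugate takes the base point [a] to [x j * a]. *)
pose rho (j : 'I_4) := face_aut (a^-1 * xG p1 (2 * q) p3 j * a).
have autJ g h : face_aut (a^-1 * (g * h) * a) =
    face_aut (a^-1 * g * a) * face_aut (a^-1 * h * a).
  by rewrite -face_autM !mulgA mulgK.
have rho2 j : rho j * rho j = 1.
  by rewrite /rho -autJ xG_sqr mulg1 mulVg face_aut1.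
have all_conj (f : aut face) : exists h, f = face_aut (a^-1 * h * a).
  have [g ->] := face_aut_surj f; exists (a * g * a^-1).
  by rewrite !mulgA mulVg mul1g mulgVK.
exists rho; split.
- move=> j; rewrite (_ : aut_fun (rho j) @` flag a = flag (xG p1 (2 * q) p3 j * a)).
    exact: reflection_adjacent.
  by rewrite [LHS]face_act_flag !mulgA mulgV mul1g.
- apply/seteqP; split=> // f _; have [h ->] := all_conj f.
  have sub := gen_subgroupP (range rho).
  have : gsub predT h by exact: gsubT.
  move: h; apply: gsub_indl => [|j h j4 _ _ IH].
    by rewrite mulg1 mulVg face_aut1; exact: sub.1.
  rewrite autJ; apply: (is_subgroupM sub) IH; apply: sub_gen_subgroup.
  by exists (inord j).
pose S := rotation_subgroup rho.
have sS : is_subgroup S by exact: gen_subgroupP.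
(* The rotation subgroup is generated by consecutive products only; these telescope. *)
have S0 (j : 'I_4) : S (rho ord0 * rho j).
  have step (i k : 'I_4) : k = i.+1 :> nat -> S (rho ord0 * rho i) ->
      S (rho ord0 * rho k).
    move=> ki Si; have Sik : S (rho i * rho k).
      by apply: sub_gen_subgroup; exists i, k.
    have := is_subgroupM sS Si Sik.
    by rewrite -mulgA (mulgA (rho i)) rho2 mul1g.
  case: j => n; elim: n => [|n IHn] n4.
    by rewrite (_ : Ordinal n4 = ord0) ?rho2; [exact: sS.1 | exact: val_inj].
  exact: (@step (Ordinal (ltnW n4))).
have [phi phiE] := sign_image p1 q p3 int.
have phi_gen (j : 'I_4) : phi (xG p1 (2 * q) p3 j) = reflection 0%R.
  by rewrite -[j]inord_val phiE.
have phiJ g : phi (a^-1 * g * a) = 1 -> phi g = 1.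
  move=> e; have -> : g = a * (a^-1 * g * a) * a^-1.
    by rewrite !mulgA mulgV mul1g mulgK.
  by rewrite gmulfM gmulfM e mulg1 -gmulfM mulgV gmulf1.
(* Rotations have sign 1, whereas [rho ord0] has sign [reflection 0]; injectivity of [face_aut] lets
   the sign be read from the automorphism. *)
have S_even f : S f -> exists2 g, f = face_aut g & phi g = 1.
  move: f; apply: gen_subgroup_min.
    split; first by exists 1; [rewrite face_aut1 | exact: gmulf1].
    move=> _ _ [g -> g1] [h -> h1]; exists (g / h).
      by rewrite face_autM face_autV.
    by rewrite gmulfF g1 h1 mulgV.
  move=> _ [i [j [_ ->]]].
  exists (a^-1 * (xG p1 (2 * q) p3 i * xG p1 (2 * q) p3 j) * a).
    by rewrite autJ.
  rewrite !gmulfM !phi_gen reflection_sqr mulg1.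
  by rewrite -gmulfM mulVg gmulf1.
apply: (card_right_cosets2 (r := rho ord0)) => //.
  move=> /S_even[g /face_aut_inj <- /phiJ].
  by rewrite phi_gen => -[].
move=> f; have [h ->] := all_conj f.
have : gsub predT h by exact: gsubT.
move: h; apply: gsub_indr => [|j h j4 _ _ IH].
  by left; rewrite mulg1 mulVg face_aut1; exact: sS.1.
have Sj : S (rho (inord j) * rho ord0).
  have := is_subgroupV sS (S0 (inord j)).
  by rewrite invgM (mulg1_eq (rho2 _)) (mulg1_eq (rho2 _)).
rewrite autJ; case: IH => Sh; [right | left].
  by rewrite -mulgA; exact: (is_subgroupM sS Sh Sj).
have := is_subgroupM sS Sh (S0 (inord j)).
by rewrite -mulgA (mulgA (rho ord0)) rho2 mul1g.
Qed.

End Automorphisms.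

Theorem theorem4p10 (p1 p2 p3 : nat)
    (p1_gt2 : (2 < p1)%N) (p1_odd : odd p1)
    (p2_dvd : (p2 %| 2 * p1)%N) (p2_even : ~~ odd p2)
    (p3_gt0 : (0 < p3)%N) (p3_even : ~~ odd p3) :
  [/\ is_polytope 4 (face_rank p1 p2 p3),
      has_type4 (face_rank p1 p2 p3) p1 p2 p3,
      is_tight4 (face p1 p2 p3) p1 p2 p3
    & is_orientably_regular 4 (face_rank p1 p2 p3)].
Proof.
have [q p2E] : exists q, p2 = (2 * q)%N.
  by exists p2./2; rewrite mul2n even_halfK.
subst p2; have q_dvd : (q %| p1)%N by rewrite dvdn_pmul2l in p2_dvd.
split.
- exact: face_is_polytope.
- exact: face_has_type.
- exact: face_is_tight.
- exact: face_is_orientably_regular.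
Qed.
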